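(* Let $\Gamma$ be one of the simply laced Dynkin diagrams of affine type $A_n^{(1)}$ ($n\ge2$), $D_n^{(1)}$ ($n\ge4$), $E_6^{(1)}$, $E_7^{(1)}$, $E_8^{(1)}$, with vertex set $\Pi$, let $x_0\in\Pi$ be the vertex labelled $0$, put $\Pi^0:=\Pi\setminus\{x_0\}$, and let $\Gamma^0$ be the subdiagram of finite type obtained by removing vertex $0$. Let $\mathfrak{g}$ be the Chevalley algebra of type $\Gamma^0$ over a field $K$ of characteristic unequal to $2$, with root system $\Phi^0$. For $x\in\Pi^0$ let $E_x^0\in\mathfrak{n}_+$ be the element of the Chevalley basis of $\mathfrak{g}$ with simple root $\alpha_x$, and for the lowest root $\theta\in\Phi^0_-$ let $E_\theta^0\in\mathfrak{g}/\mathfrak{n}_+$ be the image of the element of the Chevalley basis of weight $\theta$. Then the map sending $x\in\Pi^0$ to $E_x^0$ and $x_0$ to $E_\theta^0$ induces a $\mathbb{Z}^\Pi$-graded isomorphism $\mathcal{L}(0)\to\mathfrak{n}_+\ltimes\mathfrak{g}/\mathfrak{n}_+$ of Lie algebras.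
   Context: Affine diagrams: $A_n^{(1)}$ is the cycle on $n+1$ vertices (vertex $0$ is any vertex); $D_n^{(1)}$ is a path $c_1,\ldots,c_{n-3}$ with two extra leaves attached to $c_1$ and two extra leaves attached to $c_{n-3}$ (vertex $0$ is one of these leaves); $E_6^{(1)}$, $E_7^{(1)}$, $E_8^{(1)}$ are the trees with one trivalent vertex and three arms with $(2,2,2)$, $(3,3,1)$, $(5,2,1)$ further vertices respectively (vertex $0$ is the end of a longest arm). $\mathcal{L}(0)$: write $\sim$ for adjacency in $\Gamma$. $\mathcal{F}$ is the quotient of the free Lie algebra over $K$ on $\Pi$ modulo $[x,y]=0$ for $x\not\sim y$; $\mathcal{L}(0)$ is the quotient of $\mathcal{F}$ by the ideal generated by all $[x,[x,y]]$, $x\in\Pi$, $y\in\mathcal{F}$. It is graded by $\mathbb{N}^\Pi\subseteq\mathbb{Z}^\Pi$, the generator $x\in\Pi$ having weight $\alpha_x$, the standard basis vector of $\mathbb{Z}^\Pi$ at $x$. Chevalley algebra: $\mathfrak{g}$ is obtained by tensoring with $K$ the $\mathbb{Z}$-span of a Chevalley basis ($H_x$ for $x\in\Pi^0$ and a root vector $E_\alpha$ for each $\alpha\in\Phi^0$) of the complex simple Lie algebra of type $\Gamma^0$. The images of the Chevalley basis in $\mathfrak{g}$ are also called the Chevalley basis of $\mathfrak{g}$. The root system $\Phi^0=\Phi^0_+\cup\Phi^0_-$ lives in $\mathbb{Z}^{\Pi^0}$ (with simple roots $\alpha_x$, $x\in\Pi^0$), which is identified with the elements of $\mathbb{Z}^\Pi$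 that are zero on $x_0$. There is a triangular decomposition $\mathfrak{g}=\mathfrak{n}_-\oplus\mathfrak{h}\oplus\mathfrak{n}_+$ with $\mathfrak{n}_\pm=\bigoplus_{\beta\in\Phi^0_\pm}\mathfrak{g}_\beta$, and $\mathfrak{g}_0=\mathfrak{h}$. The Lie algebra $\mathfrak{n}_+\ltimes\mathfrak{g}/\mathfrak{n}_+$ is the semidirect product in which $\mathfrak{g}/\mathfrak{n}_+$ has trivial Lie bracket and its natural $\mathfrak{n}_+$-module structure. Let $\delta\in\mathbb{N}^\Pi$ be the unique primitive (gcd of coefficients $1$) vector spanning the kernel of the Cartan matrix $A=(\langle\alpha_x,\alpha_y\rangle)_{x,y\in\Pi}$, where $\langle\alpha_x,\alpha_y\rangle=2$ if $x=y$, $-1$ if $x\sim y$, $0$ otherwise; the coefficient of $x_0$ in $\delta$ is $1$. The $\mathbb{Z}^\Pi$-grading on $\mathfrak{n}_+\ltimes\mathfrak{g}/\mathfrak{n}_+$: the root spaces in $\mathfrak{n}_+$ have their usual weight in $\Phi^0_+\subseteq\mathbb{Z}^{\Pi^0}$, and the image of $\mathfrak{g}_\beta$ in $\mathfrak{g}/\mathfrak{n}_+$ for $\beta\in\{0\}\cup\Phi^0_-$ has weight $\delta+\beta$. *)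

(* Defs.v *)
From HB Require Import structures.
From mathcomp Require Import all_boot all_order all_algebra.
From mathcomp Require Import generic_quotient ring_quotient.
From mathcomp Require Import boolp classical_sets reals.
From mathcomp Require Import complex.

Set Implicit Arguments.
Unset Strict Implicit.
Unset Printing Implicit Defensive.

Import Order.TTheory GRing.Theory Num.Theory.
Local Open Scope ring_scope.
Local Open Scope quotient_scope.
Local Open Scope classical_set_scope.

HB.mixin Record Lmodule_isLie (K : fieldType) L of GRing.Lmodule K L := {
  lie : L -> L -> L;
  lie_linearl : forall z : L, linear (fun x => lie x z);
  lie_linearr : forall z : L, linear (lie z);
  liexx : forall x : L, lie x x = 0;
  lie_jacobi : forall x y z : L,
    lie x (lie y z) + lie y (lie z x) + lie z (lie x y) = 0
}.

#[short(type="lieAlgType")]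
HB.structure Definition LieAlgebra (K : fieldType) :=
  {L of GRing.Lmodule K L & Lmodule_isLie K L}.

Section LieTheory.
Variables (K : fieldType) (L : lieAlgType K).
Implicit Types x y z : L.

Lemma lieDl x y z : lie (x + y) z = lie x z + lie y z.
Proof. by have := lie_linearl z 1 x y; rewrite !scale1r. Qed.
Lemma lieDr x y z : lie x (y + z) = lie x y + lie x z.
Proof. by have := lie_linearr x 1 y z; rewrite !scale1r. Qed.
Lemma lie0l z : lie 0 z = 0.
Proof. by apply: (addrI (lie 0 z)); rewrite -lieDl !addr0. Qed.
Lemma lie0r z : lie z 0 = 0.
Proof. by apply: (addrI (lie z 0)); rewrite -lieDr !addr0. Qed.
Lemma lieZl a x z : lie (a *: x) z = a *: lie x z.
Proof. by have := lie_linearl z a x 0; rewrite lie0l !addr0. Qed.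
Lemma lieZr a x z : lie x (a *: z) = a *: lie x z.
Proof. by have := lie_linearr x a z 0; rewrite lie0r !addr0. Qed.
Lemma lieNl x z : lie (- x) z = - lie x z.
Proof. by rewrite -scaleN1r lieZl scaleN1r. Qed.
Lemma lieNr x z : lie x (- z) = - lie x z.
Proof. by rewrite -scaleN1r lieZr scaleN1r. Qed.
Lemma lieC x y : lie x y = - lie y x.
Proof.
apply/eqP; rewrite -addr_eq0; apply/eqP; have := liexx (x + y).
by rewrite lieDl !lieDr !liexx add0r addr0.
Qed.
Lemma lie_derivation x y z : lie x (lie y z) = lie (lie x y) z + lie y (lie x z).
Proof.
apply/eqP; rewrite -subr_eq0 opprD addrA [lie (lie x y) z]lieC opprK.
rewrite [lie x z]lieC lieNr opprK.
by rewrite -addrA [X in _ + X]addrC addrA lie_jacobi.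
Qed.
End LieTheory.

Record submodule (K : fieldType) (V : lmodType K) := Submod {
  submod_pred :> {pred V};
  submod_closedP : subsemimod_closed submod_pred
}.
HB.instance Definition _ (K : fieldType) (V : lmodType K) (U : submodule V) :=
  GRing.isSubmodClosed.Build K V (submod_pred U) (submod_closedP U).

Record lieSubalgebra (K : fieldType) (L : lieAlgType K) := LieSubalg {
  lsub_mod :> submodule L;
  lie_closed : {in lsub_mod &, forall x y, lie x y \in lsub_mod}
}.

Record lieIdeal (K : fieldType) (L : lieAlgType K) := LieIdeal {
  lideal_mod :> submodule L;
  lie_idealr : forall x, {in lideal_mod, forall y, lie x y \in lideal_mod}
}.

Definition simple_lie (K : fieldType) (L : lieAlgType K) : Prop :=
  (exists x y : L, lie x y <> 0) /\
  forall I : lieIdeal L, (forall x, x \in I -> x = 0) \/ (forall x, x \in I).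

Section Quotient.
Variables (K : fieldType) (V : lmodType K) (U : submodule V).

Definition quotmod : Type := {ideal_quot U}.
HB.instance Definition _ := Choice.on quotmod.
HB.instance Definition _ := GRing.Zmodule.on quotmod.
HB.instance Definition _ := EqQuotient.on quotmod.
HB.instance Definition _ := ZmodQuotient.on quotmod.

Definition qpi (v : V) : quotmod := \pi v.

Lemma qpi_eq v w : (qpi v == qpi w) = (v - w \in U).
Proof. by rewrite /qpi (Quotient.idealrBE U). Qed.
Lemma qpi_eqP v w : v - w \in U -> qpi v = qpi w.
Proof. by rewrite -qpi_eq => /eqP. Qed.
Lemma qpi_reprB v : repr (qpi v) - v \in U.
Proof. by rewrite -qpi_eq /qpi reprK. Qed.
Lemma qpiK (u : quotmod) : qpi (repr u) = u.
Proof. exact: reprK. Qed.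
Lemma qpiD v w : qpi (v + w) = qpi v + qpi w.
Proof. by rewrite /qpi piE. Qed.

Definition qscale (a : K) (u : quotmod) : quotmod := qpi (a *: repr u).
Lemma qpiZ a v : qpi (a *: v) = qscale a (qpi v).
Proof.
by apply/esym/qpi_eqP; rewrite -scalerBr rpredZ // qpi_reprB.
Qed.
Fact qscaleA a b v : qscale a (qscale b v) = qscale (a * b) v.
Proof. by rewrite -[v]qpiK -!qpiZ scalerA. Qed.
Fact qscale1 : left_id 1 qscale.
Proof. by move=> v; rewrite -[v]qpiK -!qpiZ scale1r. Qed.
Fact qscaleDr : right_distributive qscale +%R.
Proof.
by move=> a v w; rewrite -[v]qpiK -[w]qpiK -qpiD -!qpiZ -qpiD scalerDr.
Qed.
Fact qscaleDl v : {morph qscale^~ v : a b / a + b}.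
Proof. by move=> a b; rewrite -[v]qpiK -!qpiZ -qpiD scalerDl. Qed.
HB.instance Definition _ :=
  GRing.Zmodule_isLmodule.Build K quotmod qscaleA qscale1 qscaleDr qscaleDl.

Fact qpi_linear : linear qpi.
Proof. by move=> a v w; rewrite qpiD qpiZ. Qed.
HB.instance Definition _ := GRing.isLinear.Build K V quotmod _ qpi qpi_linear.
End Quotient.

Section LieQuotient.
Variables (K : fieldType) (L : lieAlgType K) (I : lieIdeal L).

Definition lquot : Type := quotmod I.
HB.instance Definition _ := GRing.Lmodule.on lquot.

Definition lqpi (x : L) : lquot := qpi I x.
Definition qlie (u v : lquot) : lquot := lqpi (lie (repr u) (repr v)).

Lemma lqpiK (u : lquot) : lqpi (repr u) = u.
Proof. exact: qpiK. Qed.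
Lemma lqpi_linear : linear lqpi.
Proof. exact: linearP. Qed.
HB.instance Definition _ := GRing.isLinear.Build K L lquot _ lqpi lqpi_linear.

Lemma lqpi_lie x y : lqpi (lie x y) = qlie (lqpi x) (lqpi y).
Proof.
apply/esym/qpi_eqP.
set x' := repr _; set y' := repr _.
have -> : lie x' y' - lie x y = lie x' (y' - y) + lie (x' - x) y.
  by rewrite lieDr lieDl lieNr lieNl addrA addrNK.
apply: rpredD; first exact/lie_idealr/qpi_reprB.
by rewrite lieC rpredN; exact/lie_idealr/qpi_reprB.
Qed.
Fact qlie_linearl z : linear (fun x => qlie x z).
Proof.
move=> a x y; rewrite -[x]lqpiK -[y]lqpiK -[z]lqpiK -linearP -!lqpi_lie.
by rewrite lieDl lieZl linearP.
Qed.
Fact qlie_linearr z : linear (qlie z).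
Proof.
move=> a x y; rewrite -[x]lqpiK -[y]lqpiK -[z]lqpiK -linearP -!lqpi_lie.
by rewrite lieDr lieZr linearP.
Qed.
Fact qliexx x : qlie x x = 0.
Proof. by rewrite -[x]lqpiK -lqpi_lie liexx linear0. Qed.
Fact qlie_jacobi x y z :
  qlie x (qlie y z) + qlie y (qlie z x) + qlie z (qlie x y) = 0.
Proof.
rewrite -[x]lqpiK -[y]lqpiK -[z]lqpiK -!lqpi_lie -!linearD.
by rewrite lie_jacobi linear0.
Qed.
HB.instance Definition _ := Lmodule_isLie.Build K lquot
  qlie_linearl qlie_linearr qliexx qlie_jacobi.
End LieQuotient.

Inductive in_ideal_gen (K : fieldType) (L : lieAlgType K) (S : set L) : L -> Prop :=
| IGen x of S x : in_ideal_gen S x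
| IZero : in_ideal_gen S 0
| IAdd x y of in_ideal_gen S x & in_ideal_gen S y : in_ideal_gen S (x + y)
| IScale a x of in_ideal_gen S x : in_ideal_gen S (a *: x)
| ILie x y of in_ideal_gen S y : in_ideal_gen S (lie x y).

Section IdealGen.
Variables (K : fieldType) (L : lieAlgType K) (S : set L).

Definition ideal_gen_pred : {pred L} := fun x => `[< in_ideal_gen S x >].

Fact ideal_gen_submod : subsemimod_closed ideal_gen_pred.
Proof.
split; first split.
- exact/asboolP/IZero.
- by move=> x y /asboolP Sx /asboolP Sy; apply/asboolP/IAdd.
- by move=> a x /asboolP Sx; apply/asboolP/IScale.
Qed.
Fact ideal_gen_lie x :
  {in ideal_gen_pred, forall y, lie x y \in ideal_gen_pred}.
Proof. by move=> y /asboolP Sy; apply/asboolP/ILie. Qed.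

Definition ideal_gen : lieIdeal L :=
  @LieIdeal K L (Submod ideal_gen_submod) ideal_gen_lie.
End IdealGen.

(* The free Lie algebra on X: formal terms modulo the smallest congruence that
   makes the vector space and Lie algebra identities hold. *)
Section FreeLie.
Variables (K : fieldType) (X : Type).

Inductive lterm : Type :=
| TGen of X
| TZero
| TOpp of lterm
| TAdd of lterm & lterm
| TScale of K & lterm
| TLie of lterm & lterm.

Inductive teq : lterm -> lterm -> Prop :=
| teq_refl s : teq s s
| teq_sym s t of teq s t : teq t s
| teq_trans t s u of teq s t & teq t u : teq s u
| teq_opp s s' of teq s s' : teq (TOpp s) (TOpp s')
| teq_add s s' t t' of teq s s' & teq t t' : teq (TAdd s t) (TAdd s' t')
| teq_scale a s s' of teq s s' : teq (TScale a s) (TScale a s')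
| teq_lie s s' t t' of teq s s' & teq t t' : teq (TLie s t) (TLie s' t')
| teq_addA s t u : teq (TAdd s (TAdd t u)) (TAdd (TAdd s t) u)
| teq_addC s t : teq (TAdd s t) (TAdd t s)
| teq_add0 s : teq (TAdd TZero s) s
| teq_addN s : teq (TAdd (TOpp s) s) TZero
| teq_scaleA a b s : teq (TScale a (TScale b s)) (TScale (a * b) s)
| teq_scale1 s : teq (TScale 1 s) s
| teq_scaleDr a s t : teq (TScale a (TAdd s t)) (TAdd (TScale a s) (TScale a t))
| teq_scaleDl a b s : teq (TScale (a + b) s) (TAdd (TScale a s) (TScale b s))
| teq_lieDl a s t u :
    teq (TLie (TAdd (TScale a s) t) u) (TAdd (TScale a (TLie s u)) (TLie t u))
| teq_lieDr a s t u :
    teq (TLie u (TAdd (TScale a s) t)) (TAdd (TScale a (TLie u s)) (TLie u t))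
| teq_liexx s : teq (TLie s s) TZero
| teq_jacobi s t u :
    teq (TAdd (TAdd (TLie s (TLie t u)) (TLie t (TLie u s))) (TLie u (TLie s t)))
        TZero.

HB.instance Definition _ := gen_eqMixin lterm.
HB.instance Definition _ := gen_choiceMixin lterm.

Definition teqb : rel lterm := fun s t => `[< teq s t >].
Fact teqb_equiv : equiv_class_of teqb.
Proof.
split=> [s|s t|t s u].
- exact/asboolP/teq_refl.
- by apply/asboolP/asboolP => st; apply: teq_sym.
- by move=> /asboolP st /asboolP tu; apply/asboolP/(teq_trans st tu).
Qed.
Canonical teqb_equivRel := EquivRelPack teqb_equiv.
Canonical teqb_encModRel := defaultEncModRel teqb.

Definition freeLie : Type := {eq_quot teqb}.
HB.instance Definition _ := Choice.on freeLie.
HB.instance Definition _ := EqQuotient.on freeLie.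

Definition fpi (s : lterm) : freeLie := \pi s.
Lemma fpi_eqP s t : fpi s = fpi t <-> teq s t.
Proof.
split=> [/eqP|st]; last by apply/eqmodP/asboolP.
by move/eqP/eqmodP/asboolP.
Qed.
Lemma fpiK (u : freeLie) : fpi (repr u) = u.
Proof. exact: reprK. Qed.
Lemma repr_fpi s : teq (repr (fpi s)) s.
Proof. by apply/fpi_eqP; rewrite fpiK. Qed.

Definition fopp (u : freeLie) : freeLie := fpi (TOpp (repr u)).
Definition fadd (u v : freeLie) : freeLie := fpi (TAdd (repr u) (repr v)).
Definition fscale a (u : freeLie) : freeLie := fpi (TScale a (repr u)).
Definition flie (u v : freeLie) : freeLie := fpi (TLie (repr u) (repr v)).
Definition fgen (x : X) : freeLie := fpi (TGen x).

Lemma fpi_opp s : fopp (fpi s) = fpi (TOpp s).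
Proof. exact/fpi_eqP/teq_opp/repr_fpi. Qed.
Lemma fpi_add s t : fadd (fpi s) (fpi t) = fpi (TAdd s t).
Proof. by apply/fpi_eqP/teq_add; apply: repr_fpi. Qed.
Lemma fpi_scale a s : fscale a (fpi s) = fpi (TScale a s).
Proof. exact/fpi_eqP/teq_scale/repr_fpi. Qed.
Lemma fpi_lie s t : flie (fpi s) (fpi t) = fpi (TLie s t).
Proof. by apply/fpi_eqP/teq_lie; apply: repr_fpi. Qed.
Let fpiE := (fpi_opp, fpi_add, fpi_scale, fpi_lie).

Fact faddA : associative fadd.
Proof.
move=> u v w; rewrite -[u]fpiK -[v]fpiK -[w]fpiK !fpiE.
exact/fpi_eqP/teq_addA.
Qed.
Fact faddC : commutative fadd.
Proof. by move=> u v; rewrite -[u]fpiK -[v]fpiK !fpiE; exact/fpi_eqP/teq_addC. Qed.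
Fact fadd0 : left_id (fpi TZero) fadd.
Proof. by move=> u; rewrite -[u]fpiK !fpiE; exact/fpi_eqP/teq_add0. Qed.
Fact faddN : left_inverse (fpi TZero) fopp fadd.
Proof. by move=> u; rewrite -[u]fpiK !fpiE; exact/fpi_eqP/teq_addN. Qed.
HB.instance Definition _ := GRing.isZmodule.Build freeLie faddA faddC fadd0 faddN.

Fact fscaleA a b u : fscale a (fscale b u) = fscale (a * b) u.
Proof. by rewrite -[u]fpiK !fpiE; exact/fpi_eqP/teq_scaleA. Qed.
Fact fscale1 : left_id 1 fscale.
Proof. by move=> u; rewrite -[u]fpiK !fpiE; exact/fpi_eqP/teq_scale1. Qed.
Fact fscaleDr : right_distributive fscale +%R.
Proof.
move=> a u v; rewrite -[u]fpiK -[v]fpiK /GRing.add /= !fpiE.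
exact/fpi_eqP/teq_scaleDr.
Qed.
Fact fscaleDl u : {morph fscale^~ u : a b / a + b}.
Proof.
move=> a b; rewrite -[u]fpiK [in RHS]/GRing.add /= !fpiE.
exact/fpi_eqP/teq_scaleDl.
Qed.
HB.instance Definition _ :=
  GRing.Zmodule_isLmodule.Build K freeLie fscaleA fscale1 fscaleDr fscaleDl.

Fact flie_linearl z : linear (fun x => flie x z).
Proof.
move=> a u v; rewrite -[u]fpiK -[v]fpiK -[z]fpiK.
rewrite /GRing.add /GRing.scale /= !fpiE; exact/fpi_eqP/teq_lieDl.
Qed.
Fact flie_linearr z : linear (flie z).
Proof.
move=> a u v; rewrite -[u]fpiK -[v]fpiK -[z]fpiK.
rewrite /GRing.add /GRing.scale /= !fpiE; exact/fpi_eqP/teq_lieDr.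
Qed.
Fact fliexx x : flie x x = 0.
Proof. by rewrite -[x]fpiK !fpiE; exact/fpi_eqP/teq_liexx. Qed.
Fact flie_jacobi x y z :
  flie x (flie y z) + flie y (flie z x) + flie z (flie x y) = 0.
Proof.
rewrite -[x]fpiK -[y]fpiK -[z]fpiK /GRing.add /= !fpiE.
exact/fpi_eqP/teq_jacobi.
Qed.
HB.instance Definition _ := Lmodule_isLie.Build K freeLie
  flie_linearl flie_linearr fliexx flie_jacobi.
End FreeLie.

(* For a subalgebra N of L: the semidirect product N |>< L/N, in which the
   N-module L/N is an abelian ideal. *)
Section Semidirect.
Variables (K : fieldType) (L : lieAlgType K) (N : lieSubalgebra L).

Record sublie := SubLie { sublie_val : L; sublie_valP : sublie_val \in N }.
HB.instance Definition _ := [isSub for sublie_val].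
HB.instance Definition _ := [Choice of sublie by <:].
HB.instance Definition _ := [SubChoice_isSubLmodule of sublie by <:].

Definition nlie (x y : sublie) : sublie :=
  SubLie (lie_closed (sublie_valP x) (sublie_valP y)).
Fact nlie_linearl z : linear (fun x => nlie x z).
Proof. by move=> a x y; apply: val_inj; rewrite linearP /= lieDl lieZl. Qed.
Fact nlie_linearr z : linear (nlie z).
Proof. by move=> a x y; apply: val_inj; rewrite linearP /= lieDr lieZr. Qed.
Fact nliexx x : nlie x x = 0.
Proof. by apply: val_inj; rewrite linear0 /= liexx. Qed.
Fact nlie_jacobi x y z :
  nlie x (nlie y z) + nlie y (nlie z x) + nlie z (nlie x y) = 0.
Proof. by apply: val_inj; rewrite linear0 !linearD /= lie_jacobi. Qed.
HB.instance Definition _ := Lmodule_isLie.Build K sublie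
  nlie_linearl nlie_linearr nliexx nlie_jacobi.

Definition nact (x : sublie) (u : quotmod N) : quotmod N :=
  qpi N (lie (val x) (repr u)).

Lemma nact_qpi x v : nact x (qpi N v) = qpi N (lie (val x) v).
Proof.
by apply: qpi_eqP; rewrite -lieNr -lieDr lie_closed ?qpi_reprB ?sublie_valP.
Qed.
Lemma nact_linear x : linear (nact x).
Proof.
move=> a u v; rewrite -[u]qpiK -[v]qpiK -linearP !nact_qpi.
by rewrite lieDr lieZr linearP.
Qed.
Lemma nact_linearl u : linear (nact^~ u).
Proof. by move=> a x y; rewrite /nact linearP lieDl lieZl linearP. Qed.
Lemma nact_lie x y u : nact (nlie x y) u = nact x (nact y u) - nact y (nact x u).
Proof.
by rewrite -[u]qpiK !nact_qpi -linearB lie_derivation addrK.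
Qed.

Definition semidirect : Type := (sublie * quotmod N)%type.
HB.instance Definition _ := GRing.Lmodule.on semidirect.

Definition sdlie (p q : semidirect) : semidirect :=
  (nlie p.1 q.1, nact p.1 q.2 - nact q.1 p.2).

Fact sdlie_linearl z : linear (fun p => sdlie p z).
Proof.
move=> a p q; congr pair; first exact: nlie_linearl.
rewrite /= nact_linearl nact_linear scalerBr opprD !addrA.
by congr (_ + _); rewrite -!addrA; congr (_ + _); rewrite addrC.
Qed.
Fact sdlie_linearr z : linear (sdlie z).
Proof.
move=> a p q; congr pair; first exact: nlie_linearr.
rewrite /= nact_linearl nact_linear scalerBr opprD !addrA.
by congr (_ + _); rewrite -!addrA; congr (_ + _); rewrite addrC.
Qed.
Fact sdliexx p : sdlie p p = 0.
Proof. by rewrite /sdlie nliexx subrr. Qed.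
Fact sdlie_jacobi p q r :
  sdlie p (sdlie q r) + sdlie q (sdlie r p) + sdlie r (sdlie p q) = 0.
Proof.
have nactB x u v : nact x (u - v) = nact x u - nact x v.
  by rewrite -scaleN1r addrC nact_linear scaleN1r addrC.
congr pair; first exact: nlie_jacobi.
rewrite /= !nactB !nact_lie !opprB.
rewrite (AC ((2*2)*(2*2)*(2*2))
  ((1*12)*(2*7)*(3*10)*(4*5)*(6*11)*(8*9))) /=.
by rewrite !subrr !addNr !addr0.
Qed.
HB.instance Definition _ := Lmodule_isLie.Build K semidirect
  sdlie_linearl sdlie_linearr sdliexx sdlie_jacobi.
End Semidirect.

Section Spans.
Variables (K : fieldType) (V : lmodType K).

Definition span (S : set V) : set V :=
  [set v | exists2 s : seq (K * V),
     forall p, p \in s -> S p.2 & v = \sum_(p <- s) p.1 *: p.2].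

Definition zspan (S : set V) : set V :=
  [set v | exists2 s : seq (int * V),
     forall p, p \in s -> S p.2 & v = \sum_(p <- s) p.2 *~ p.1].

Definition is_basis (I : eqType) (P : set I) (e : I -> V) : Prop :=
  (forall v, span (e @` P) v) /\
  (forall (s : seq I) (c : I -> K), uniq s -> (forall i, i \in s -> P i) ->
     \sum_(i <- s) c i *: e i = 0 -> forall i, i \in s -> c i = 0).

Definition span_pred (S : set V) : {pred V} := fun v => `[< span S v >].

Lemma span_incl (S : set V) v : S v -> span S v.
Proof.
move=> Sv; exists [:: (1, v)]; last by rewrite big_seq1 scale1r.
by move=> p; rewrite inE => /eqP ->.
Qed.
Lemma span_closed (S : set V) : subsemimod_closed (span_pred S).
Proof.
split; first split.
- by apply/asboolP; exists [::]; rewrite ?big_nil.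
- move=> _ _ /asboolP[s Ss ->] /asboolP[r Sr ->]; apply/asboolP.
  exists (s ++ r); last by rewrite big_cat.
  by move=> p; rewrite mem_cat => /orP[/Ss|/Sr].
- move=> a _ /asboolP[s Ss ->]; apply/asboolP.
  exists [seq (a * p.1, p.2) | p <- s]; first by move=> _ /mapP[p /Ss ? ->].
  by rewrite big_map scaler_sumr; apply: eq_bigr => p _; rewrite scalerA.
Qed.
Definition span_mod (S : set V) : submodule V := Submod (@span_closed S).

Lemma zspan_incl (S : set V) v n : S v -> zspan S (v *+ n).
Proof.
move=> Sv; exists [:: (n%:Z, v)]; last by rewrite big_seq1.
by move=> p; rewrite inE => /eqP ->.
Qed.
Lemma zspan_inclN (S : set V) v n : S v -> zspan S (- (v *+ n)).
Proof.
move=> Sv; exists [:: (- n%:Z, v)]; last by rewrite big_seq1 mulrNz.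
by move=> p; rewrite inE => /eqP ->.
Qed.
End Spans.

Inductive affine_type : Type :=
| AffA n of (2 <= n)%N
| AffD n of (4 <= n)%N
| AffE6
| AffE7
| AffE8.

Definition affine_rank (t : affine_type) : nat :=
  match t with
  | AffA n _ => n | AffD n _ => n | AffE6 => 6 | AffE7 => 7 | AffE8 => 8
  end.

(* D_n: leaves 0, 1 at vertex 2, path 2, ..., n-2, leaves n-1, n at n-2.
   E_n: the arms issue from vertices 2, 3, 5 respectively. *)
Definition affine_edges (t : affine_type) : seq (nat * nat) :=
  match t with
  | AffA n _ => (n, 0%N) :: [seq (i, i.+1) | i <- iota 0 n]
  | AffD n _ => [:: (0, 2); (1, 2); (n - 2, n - 1); (n - 2, n)]%N
                ++ [seq (i, i.+1) | i <- iota 2 (n - 4)]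
  | AffE6 => [:: (0, 1); (1, 2); (2, 3); (3, 4); (2, 5); (5, 6)]%N
  | AffE7 => [:: (0, 1); (1, 2); (2, 3); (3, 4); (4, 5); (5, 6); (3, 7)]%N
  | AffE8 => [:: (0, 1); (1, 2); (2, 3); (3, 4); (4, 5); (5, 6); (6, 7);
                 (5, 8)]%N
  end.

(* Pi, with x_0 = ord0, and the lattice Z^Pi; Pi^0 is given by x != x0, and
   Z^(Pi^0) consists of the weights vanishing at x0. *)
Notation vertex t := 'I_(affine_rank t).+1.
Notation weight t := {ffun 'I_(affine_rank t).+1 -> int}.
Notation x0 := ord0.

Section Roots.
Variable t : affine_type.
Implicit Types (x y : vertex t) (b c : weight t).

Definition adjacent x y : bool :=
  ((val x, val y) \in affine_edges t) || ((val y, val x) \in affine_edges t).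

Definition alpha x : weight t := [ffun y => (y == x)%:R].

Definition cartan x y : int :=
  if x == y then 2 else if adjacent x y then -1 else 0.

Definition cform b c : int := \sum_x \sum_y b x * c y * cartan x y.

Definition reflection x b : weight t := b - alpha x *~ cform b (alpha x).

(* Phi^0: the orbit of the simple roots under the Weyl group of Gamma^0. *)
Inductive root0 : weight t -> Prop :=
| Root_simple x of x != x0 : root0 (alpha x)
| Root_reflection x b of x != x0 & root0 b : root0 (reflection x b).

Definition pos_root : set (weight t) :=
  [set b | root0 b /\ forall x, 0 <= b x].
Definition neg_root : set (weight t) :=
  [set b | root0 b /\ forall x, b x <= 0].

Definition lowest_root (theta : weight t) : Prop :=
  neg_root theta /\ forall b, root0 b -> forall x, theta x <= b x.

(* delta is primitive and spans the kernel of the Cartan matrix over Q. *)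
Definition is_null_root (delta : {ffun vertex t -> nat}) : Prop :=
  \big[gcdn/0%N]_x delta x = 1%N /\
  forall v : vertex t -> rat,
    (forall x, \sum_y (cartan x y)%:~R * v y = 0) <->
    (exists a : rat, forall x, v x = a * (delta x)%:R).
End Roots.

Section ChevalleyBasis.
Variables (t : affine_type) (F : fieldType) (L : lieAlgType F).
Variables (H : vertex t -> L) (E : weight t -> L).

(* Only the H x with x != x0 and the E b with b a root are meaningful. *)
Definition chev_index : set (vertex t + weight t) :=
  [set i | match i with inl x => x != x0 | inr b => root0 b end].
Definition chev_family (i : vertex t + weight t) : L :=
  match i with inl x => H x | inr b => E b end.

(* The p such that b - p a is the end of the a-string through b. *)
Definition string_end (a b : weight t) (p : nat) : Prop :=
  root0 (b - a *+ p) /\ forall q : nat, root0 (b - a *+ q) -> (q <= p)%N.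

(* L is a simple Lie algebra of type Gamma^0 with Chevalley basis H, E: the
   H x span a Cartan subalgebra with root system Phi^0 and are the coroots of
   the simple roots alpha x. As Phi^0 is simply laced, the coroot of b is
   \sum_x b x * H x and the value of b on the coroot of alpha x is
   cform b (alpha x). *)
Record is_chevalley_basis : Prop := IsChevalleyBasis {
  cb_simple : simple_lie L;
  cb_basis : is_basis chev_index chev_family;
  cb_HH : forall x y, x != x0 -> y != x0 -> lie (H x) (H y) = 0;
  cb_HE : forall x b, x != x0 -> root0 b ->
    lie (H x) (E b) = (cform b (alpha x))%:~R *: E b;
  cb_EN : forall b, root0 b ->
    lie (E b) (E (- b)) = \sum_(x | x != x0) H x *~ b x;
  cb_EE : forall a b, root0 a -> root0 b -> root0 (a + b) ->
    exists2 p : nat, string_end a b p &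
      lie (E a) (E b) = E (a + b) *+ p.+1 \/
      lie (E a) (E b) = - (E (a + b) *+ p.+1);
  cb_EE0 : forall a b, root0 a -> root0 b -> a + b <> 0 -> ~ root0 (a + b) ->
    lie (E a) (E b) = 0
}.
End ChevalleyBasis.

(* The Chevalley algebra of type Gamma^0 over K. It is the tensor product with K
   of the Lie ring spanned over Z by a Chevalley basis of the complex algebra:
   cx_red, used on that Z-span only, is z |-> z (x) 1, and maps the given Z-basis
   to a K-basis. *)
Record chevalley_algebra (t : affine_type) (R : realType) (K : fieldType) :=
ChevalleyAlgebra {
  cx_lie : lieAlgType R[i];
  cx_H : vertex t -> cx_lie;
  cx_E : weight t -> cx_lie;
  cx_basis : is_chevalley_basis cx_H cx_E;
  cx_span := zspan (chev_family cx_H cx_E @` @chev_index t);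
  chev_lie :> lieAlgType K;
  chev_H : vertex t -> chev_lie;
  chev_E : weight t -> chev_lie;
  chev_basis : is_basis (@chev_index t) (chev_family chev_H chev_E);
  cx_red : cx_lie -> chev_lie;
  cx_redD : forall u v, cx_span u -> cx_span v ->
    cx_red (u + v) = cx_red u + cx_red v;
  cx_red_lie : forall u v, cx_span u -> cx_span v ->
    cx_red (lie u v) = lie (cx_red u) (cx_red v);
  cx_redE : forall i, @chev_index t i ->
    cx_red (chev_family cx_H cx_E i) = chev_family chev_H chev_E i
}.

Section NPlus.
Variables (t : affine_type) (R : realType) (K : fieldType).
Variable g : chevalley_algebra t R K.
Implicit Types (a b : weight t).

Lemma cx_red0 : cx_red (0 : cx_lie g) = 0.
Proof.
have S0 : cx_span (0 : cx_lie g) by exists [::]; rewrite ?big_nil.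
by apply: (addrI (cx_red (0 : cx_lie g))); rewrite -cx_redD // !addr0.
Qed.

Lemma cx_red_root b : root0 b -> cx_red (cx_E g b) = chev_E g b.
Proof. exact: (@cx_redE _ _ _ g (inr b)). Qed.

Lemma cx_index_root b : root0 b ->
  (chev_family (cx_H g) (cx_E g) @` @chev_index t) (cx_E g b).
Proof. by exists (inr b). Qed.

Lemma cx_red_muln b n : root0 b -> cx_red (cx_E g b *+ n) = chev_E g b *+ n.
Proof.
move=> rb; have Sb := cx_index_root rb.
elim: n => [|n IHn]; first by rewrite !mulr0n cx_red0.
rewrite !mulrSr cx_redD ?IHn ?cx_red_root //; first exact: zspan_incl.
by rewrite -[cx_E g b]mulr1n; exact: zspan_incl.
Qed.

Lemma cx_red_oppn b n : root0 b -> cx_red (- (cx_E g b *+ n)) = - (chev_E g b *+ n).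
Proof.
move=> rb; have Sb := cx_index_root rb.
apply: (addIr (cx_red (cx_E g b *+ n))); rewrite -cx_redD.
- by rewrite addNr cx_red0 cx_red_muln // addNr.
- exact: zspan_inclN.
- exact: zspan_incl.
Qed.

Definition nplus_mod : submodule g := span_mod (chev_E g @` @pos_root t).

Lemma nplus_gen a b : pos_root a -> pos_root b ->
  lie (chev_E g a) (chev_E g b) \in nplus_mod.
Proof.
move=> [ra a0] [rb b0].
have [ab0|/eqP ab0] := eqVneq (a + b) 0.
  have -> : a = b.
    apply/ffunP => x; have /ffunP/(_ x) := ab0; rewrite !ffunE => abx.
    have : a x == 0 by rewrite eq_le a0 -[X in _ <= X]abx lerDl b0.
    by move=> /eqP ax; move: abx; rewrite ax add0r.
  by rewrite liexx rpred0.
have Sa := zspan_incl 1 (cx_index_root ra); have Sb := zspan_incl 1 (cx_index_root rb).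
rewrite -!cx_red_root // -cx_red_lie //.
have [rab|nrab] := pselect (root0 (a + b)); last first.
  by rewrite (cb_EE0 (cx_basis g)) // cx_red0 rpred0.
have Eab : chev_E g (a + b) \in nplus_mod.
  apply/asboolP/span_incl; exists (a + b) => //; split=> // x.
  by rewrite ffunE addr_ge0.
have [p _ [->|->]] := cb_EE (cx_basis g) ra rb rab.
  by rewrite cx_red_muln // rpredMn.
by rewrite cx_red_oppn // rpredN rpredMn.
Qed.

Lemma nplus_closed : {in nplus_mod &, forall x y, lie x y \in nplus_mod}.
Proof.
move=> _ _ /asboolP[s Ss ->] /asboolP[r Sr ->].
have lsuml y : {morph (fun x : g => lie x y) : u v / u + v}.
  by move=> u v; rewrite lieDl.
rewrite (big_morph _ (lsuml _) (lie0l _)) big_seq rpred_sum // => p /Ss[a pa <-].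
rewrite lieZl rpredZ // (big_morph _ (lieDr _) (lie0r _)) big_seq.
rewrite rpred_sum // => q /Sr[b pb <-]; rewrite lieZr rpredZ //.
exact: nplus_gen.
Qed.

Definition nplus : lieSubalgebra g := LieSubalg nplus_closed.

(* g_b: spanned by E b if b is a root, by the H x if b = 0, zero otherwise. *)
Definition weight_space b : set g :=
  span [set v | (root0 b /\ v = chev_E g b) \/
                (b = 0 /\ exists2 x, x != x0 & v = chev_H g x)].

(* For mu a positive root, resp. mu - delta a negative root or 0, this is the
   root space in n_+, resp. the image of g_(mu - delta) in g/n_+; it is 0 for
   the other mu. *)
Definition sd_component (delta : {ffun vertex t -> nat}) (mu : weight t) :
    set (semidirect nplus) :=
  [set p | weight_space mu (val p.1) /\
     exists2 v, weight_space (mu - [ffun x => (delta x)%:Z]) v & p.2 = qpi nplus v].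
End NPlus.

Section L0.
Variables (K : fieldType) (t : affine_type).

Definition calF : lieAlgType K :=
  lquot (ideal_gen [set z : freeLie K (vertex t) | exists x y : vertex t,
    ~~ adjacent x y /\ z = lie (fgen K x) (fgen K y)]).
Definition calF_gen (x : vertex t) : calF := lqpi _ (fgen K x).

Definition L0 : lieAlgType K :=
  lquot (ideal_gen [set z : calF | exists (x : vertex t) (y : calF),
    z = lie (calF_gen x) (lie (calF_gen x) y)]).
Definition L0_gen (x : vertex t) : L0 := lqpi _ (calF_gen x).

Inductive L0_monomial : weight t -> L0 -> Prop :=
| Mon_gen x : L0_monomial (alpha x) (L0_gen x)
| Mon_lie mu nu u v of L0_monomial mu u & L0_monomial nu v :
    L0_monomial (mu + nu) (lie u v).

Definition L0_component (mu : weight t) : set L0 := span (L0_monomial mu).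
End L0.

(* Main.v *)
Require Import Defs.
From HB Require Import structures.
From mathcomp Require Import all_boot all_order all_algebra.
From mathcomp Require Import zify ring.
From mathcomp Require Import boolp classical_sets reals.
Require Import Defs.

(** Let <b, c> be the form of the Cartan matrix.  It is positive semidefinite
    with radical spanned by delta, and delta has coefficient 1 at x0.  Hence the
    roots of g are the vectors of norm 2 vanishing at x0, the lowest one is
    alpha_x0 - delta, and the weights of the semidirect product are the vectors
    c of norm 2 with 0 <= c <= delta (each once: positive roots if c x0 = 0, and
    delta + negative roots if c x0 = 1) together with delta itself, which
    carries a copy of h.  The definition [short_root] treats all
    vertices alike, so that x0 needs no separate discussion in L(0).

    Upper bound for L(0).  If X = ad x has square zero for a generator x, then
    expanding ad [x, [x, y]] = 0 gives 2 X (ad y) X = 0, so X (ad y) X = 0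
    outside characteristic 2 ([sandwich_middle]).  Consider the left-normed
    monomials all of whose partial weights are short roots ([root_mono]).  By
    induction on the height ([root_mono_main]) two of them with the same weight
    agree up to sign, and x kills a monomial of weight c when <c, alpha_x> >= 0.
    The remaining values are <c, alpha_x> = -1, where c + alpha_x is again short,
    and <c, alpha_x> = -2, where c + alpha_x = delta.  The elements of weight
    delta so obtained are killed by all generators, therefore the monomials and
    these elements span L(0) ([L0_component_mono]).  In weight delta there is one
    such element up to sign for each vertex, and the one for x0 is a
    combination of the others ([null_mono_span]).

    Lower bound.  The images prescribed for the generators satisfy the relations
    ([sd_gen_comm], [sd_gen_sandwich]), which gives the homomorphism
    ([L0_lift]).  In a simply laced system all nonzero structure constants
    between roots are 1 or -1, so each monomial, and each element of weight delta
    at a vertex other than x0, goes to plus or minus a vector of a basis of the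
    semidirect product ([phi_root_mono], [phi_null_mono]); every basis vector
    is reached, and the elements over the same one agree up to sign.
    Bijectivity and the compatibility with the gradings follow. *)

Set Implicit Arguments.
Unset Strict Implicit.
Unset Printing Implicit Defensive.
Import Order.TTheory GRing.Theory Num.Theory.
Local Open Scope ring_scope.

(** * The coefficients of the null root *)

(** Marks of the affine diagrams; for D_n, 2 on the path and 1 on the four
    leaves. *)
Definition mark (t : affine_type) (i : nat) : nat :=
  match t with
  | AffA _ _ => 1
  | AffD n _ => if (2 <= i <= n - 2)%N then 2 else 1
  | AffE6 => nth 0 [:: 1; 2; 3; 2; 1; 2; 1] i
  | AffE7 => nth 0 [:: 1; 2; 3; 4; 3; 2; 1; 2] i
  | AffE8 => nth 0 [:: 1; 2; 3; 4; 5; 6; 4; 2; 3] i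
  end%N.

Lemma mem_path_edges m k a b :
  ((a, b) \in [seq (i, i.+1) | i <- iota m k])
  = (m <= a < m + k)%N && (b == a.+1).
Proof.
apply/mapP/andP => [[i]|[ha /eqP ->]]; last by exists a; rewrite // mem_iota.
by rewrite mem_iota => hi [-> ->].
Qed.

(** Turns a row of the Cartan matrix into a sum over an explicit list of
    neighbours, which can be computed case by case. *)
Lemma sum_cartan (t : affine_type) (x : vertex t) (d : nat -> nat) (s : seq nat) :
  uniq s -> all (fun k => k <= affine_rank t)%N s ->
  (forall y : vertex t, (val y \in s) = (x != y) && adjacent x y) ->
  \sum_y cartan x y * (d y)%:Z = 2 * (d x)%:Z - \sum_(k <- s) (d k)%:Z.
Proof.
move=> Us Ss Es.
have -> : \sum_(k <- s) (d k)%:Z = \sum_(y : vertex t | val y \in s) (d y)%:Z.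
  rewrite [RHS](eq_bigl (fun y => y \in [seq inord k | k <- s])); last first.
    move=> y /=; apply/idP/mapP => [ys|[k ks ->]].
      by exists (val y) => //; rewrite inord_val.
    by rewrite inordK // ltnS (allP Ss).
  rewrite -big_uniq /=.
    rewrite big_map big_seq [RHS]big_seq; apply: eq_bigr => k ks.
    by rewrite inordK // ltnS (allP Ss).
  rewrite map_inj_in_uniq // => i j /(allP Ss) hi /(allP Ss) hj.
  by move/(congr1 val); rewrite /= !inordK.
rewrite (bigD1 x) //= /cartan eqxx; congr (_ + _).
rewrite -sumrN [RHS]big_mkcond [LHS]big_mkcond /=; apply: eq_bigr => y _.
rewrite Es eq_sym; case: (altP (x =P y)) => //= _.
by case: adjacent; rewrite ?mul0r ?mulN1r.
Qed.

Lemma sum_cartan_iota (t : affine_type) (x : vertex t) (d : nat -> nat) :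
  let adj (i j : nat) := ((i, j) \in affine_edges t) || ((j, i) \in affine_edges t) in
  \sum_y cartan x y * (d y)%:Z
  = 2 * (d x)%:Z -
    \sum_(k <- iota 0 (affine_rank t).+1 | (val x != k) && adj (val x) k) (d k)%:Z.
Proof.
move=> adj; rewrite -[X in _ - X]big_filter; apply: sum_cartan => [||y].
- by rewrite filter_uniq // iota_uniq.
- by apply/allP => k; rewrite mem_filter mem_iota; lia.
- by rewrite mem_filter mem_iota /= -val_eqE ltn_ord andbT.
Qed.

Lemma cartan_mark_A n (hn : (2 <= n)%N) (x : vertex (AffA hn)) :
  \sum_y cartan x y * (mark (AffA hn) y)%:Z = 0.
Proof.
pose sumE s := @sum_cartan _ x (mark (AffA hn)) s.
pose s := if val x == 0%N then [:: 1; n]%N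
          else if val x == n then [:: 0; n.-1]%N else [:: x.-1; x.+1]%N.
rewrite (sumE s) /s; case: x {s sumE} => x /= hx /=.
+ case: eqP => h0; first by rewrite !big_cons big_nil.
  by case: eqP => h1; rewrite !big_cons big_nil.
+ by case: eqP => h0; [|case: eqP => h1]; rewrite /= ?inE ?andbT; lia.
+ by case: eqP => h0; [|case: eqP => h1]; rewrite /= ?inE ?andbT; lia.
+ case=> y /= hy /=; rewrite /adjacent /= -val_eqE /= !inE !xpair_eqE !mem_path_edges.
  case: eqP => h0; [|case: eqP => h1]; rewrite !inE; apply/idP/idP; lia.
Qed.

(** The edges written as inequalities, so that the neighbours of a vertex can be
    found by linear arithmetic. *)
Lemma mem_edges_D n (hn : (4 <= n)%N) a b :
  ((a, b) \in affine_edges (AffD hn))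
  = [|| (a < 2)%N && (b == 2%N), (a == n - 2)%N && (n - 2 < b <= n)%N
      | (1 < a < n - 2)%N && (b == a.+1)].
Proof.
rewrite /= !inE !xpair_eqE mem_path_edges.
have [->|a0] := eqVneq a 0%N.
  by rewrite /=; apply/idP/idP; lia.
have [->|a1] := eqVneq a 1%N.
  by rewrite /=; apply/idP/idP; lia.
have [ea|a2] := eqVneq a (n - 2)%N; rewrite /=; apply/idP/idP; lia.
Qed.

Lemma cartan_mark_D n (hn : (4 <= n)%N) (x : vertex (AffD hn)) :
  \sum_y cartan x y * (mark (AffD hn) y)%:Z = 0.
Proof.
pose sumE s := @sum_cartan _ x (mark (AffD hn)) s.
pose s := if (val x < 2)%N then [:: 2%N] else if (n - 2 < val x)%N then [:: (n - 2)%N]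
          else ((if val x == 2 then [:: 0; 1]%N else [:: x.-1])
                ++ (if val x == (n - 2)%N then [:: n.-1; n] else [:: x.+1])).
rewrite (sumE s) /s; case: x {s sumE} => x /= hx /=.
+ case: (ltnP x 2) => h0; first by [rewrite big_seq1 /=; repeat (case: ifP => ?); lia].
  case: (ltnP (n - 2) x) => h1; first by [rewrite big_seq1 /=; repeat (case: ifP => ?); lia].
  rewrite big_cat /=.
  case: eqP => h2; case: eqP => h3; rewrite !big_cons !big_nil;
    rewrite /=; repeat (case: ifP => ?); lia.
+ by repeat (case: ifP => ?); rewrite /= ?inE; lia.
+ by repeat (case: ifP => ?); rewrite /=; lia.
+ case=> y /= hy /=; rewrite /adjacent !mem_edges_D -val_eqE /=.
  case: (ltnP x 2) => h0; [|case: (ltnP (n - 2) x) => h1; [|case: eqP => h2; case: eqP => h3]];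
    rewrite !inE; apply/idP/idP; lia.
Qed.

Lemma cartan_mark_E6 (x : vertex AffE6) : \sum_y cartan x y * (mark AffE6 y)%:Z = 0.
Proof.
by rewrite sum_cartan_iota; case: x => x hx /=;
  do 7?[case: x hx => [|x] hx //; first by rewrite unlock].
Qed.

Lemma cartan_mark_E7 (x : vertex AffE7) : \sum_y cartan x y * (mark AffE7 y)%:Z = 0.
Proof.
by rewrite sum_cartan_iota; case: x => x hx /=;
  do 8?[case: x hx => [|x] hx //; first by rewrite unlock].
Qed.

Lemma cartan_mark_E8 (x : vertex AffE8) : \sum_y cartan x y * (mark AffE8 y)%:Z = 0.
Proof.
by rewrite sum_cartan_iota; case: x => x hx /=;
  do 9?[case: x hx => [|x] hx //; first by rewrite unlock].
Qed.

Lemma cartan_mark (t : affine_type) (x : vertex t) :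
  \sum_y cartan x y * (mark t y)%:Z = 0.
Proof.
case: t x => [n hn|n hn|||] x.
- exact: cartan_mark_A.
- exact: cartan_mark_D.
- exact: cartan_mark_E6.
- exact: cartan_mark_E7.
- exact: cartan_mark_E8.
Qed.

(** * The quadratic form and the finite root system *)

Section Form.
Variable t : affine_type.
Implicit Types (x y : vertex t) (b c e : weight t).

Lemma weightD b c x : (b + c) x = b x + c x.
Proof. by rewrite ffunE. Qed.

Lemma weightN b x : (- b) x = - b x.
Proof. by rewrite ffunE. Qed.

Lemma weightMz b m x : (b *~ m) x = b x * m.
Proof. by rewrite ffunMzE mulrzz. Qed.

Lemma weight_alpha x y : alpha x y = (y == x)%:Z.
Proof. by rewrite ffunE; case: eqP. Qed.

Definition weightE := (weightD, weightN, weightMz, weight_alpha).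

Lemma cartanC x y : cartan x y = cartan y x.
Proof. by rewrite /cartan /adjacent eq_sym orbC. Qed.

Lemma cartanxx x : cartan x x = 2.
Proof. by rewrite /cartan eqxx. Qed.

Lemma cartan_le0 x y : x != y -> cartan x y <= 0.
Proof. by rewrite /cartan => /negPf ->; case: ifP. Qed.

Lemma cformC b c : cform b c = cform c b.
Proof.
rewrite /cform exchange_big; apply: eq_bigr => x _; apply: eq_bigr => y _ /=.
by rewrite cartanC [b _ * _]mulrC.
Qed.

Lemma cformDl b c e : cform (b + c) e = cform b e + cform c e.
Proof.
rewrite /cform -big_split; apply: eq_bigr => x _; rewrite -big_split.
by apply: eq_bigr => y _; rewrite ffunE !mulrDl.
Qed.

Lemma cformDr b c e : cform e (b + c) = cform e b + cform e c.
Proof. by rewrite !(cformC e) cformDl. Qed.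

Lemma cformNl b e : cform (- b) e = - cform b e.
Proof.
apply: (addrI (cform b e)); rewrite -cformDl subrr.
by rewrite subrr /cform big1 // => x _; rewrite big1 // => y _; rewrite ffunE !mul0r.
Qed.

Lemma cformNr b e : cform e (- b) = - cform e b.
Proof. by rewrite !(cformC e) cformNl. Qed.

Lemma cform_alphar b x : cform b (alpha x) = \sum_y b y * cartan y x.
Proof.
apply: eq_bigr => y _; rewrite (bigD1 x) //= ffunE eqxx mulr1 big1 ?addr0 // => z zx.
by rewrite ffunE (negPf zx) mulr0 mul0r.
Qed.

Lemma cform_alpha x y : cform (alpha x) (alpha y) = cartan x y.
Proof.
rewrite cform_alphar (bigD1 x) //= ffunE eqxx mul1r big1 ?addr0 // => z zx.
by rewrite ffunE (negPf zx) mul0r.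
Qed.

Lemma cform_sumr b c : cform b c = \sum_x c x * cform b (alpha x).
Proof.
rewrite cformC; apply: eq_bigr => x _; rewrite cform_alphar mulr_sumr.
by apply: eq_bigr => y _; rewrite cartanC mulrA.
Qed.

Lemma cformMzl b e m : cform (b *~ m) e = m * cform b e.
Proof.
rewrite /cform mulr_sumr; apply: eq_bigr => x _; rewrite mulr_sumr.
by apply: eq_bigr => y _; rewrite ffunMzE mulrzz; ring.
Qed.

Lemma cformMzr b e m : cform e (b *~ m) = m * cform e b.
Proof. by rewrite !(cformC e) cformMzl. Qed.

Definition cformE := (cformDl, cformDr, cformNl, cformNr, cform_alpha, cartanxx).

Lemma reflectionE x b : reflection x b = b - alpha x *~ cform b (alpha x).
Proof. by []. Qed.

Definition height b : int := \sum_x b x.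

Lemma heightB b x : height (b - alpha x) = height b - 1.
Proof.
rewrite /height (eq_bigr (fun y => b y - (y == x)%:Z)).
  rewrite sumrB [X in _ - X](bigD1 x) //= eqxx.
  by rewrite [X in _ - (_ + X)]big1 ?addr0 // => y /negPf ->.
by move=> y _; rewrite !weightE.
Qed.

Lemma height_ge b x : (forall y, 0 <= b y) -> b x <= height b.
Proof. by move=> b0; rewrite /height (bigD1 x) //= lerDl sumr_ge0. Qed.

Lemma cform_alpha_le0 b x :
  (forall y, 0 <= b y) -> b x = 0 -> cform b (alpha x) <= 0.
Proof.
move=> b0 bx; rewrite cform_alphar sumr_le0 // => y _.
have [->|yx] := eqVneq y x; first by rewrite bx mul0r.
exact: mulr_ge0_le0 (b0 y) (cartan_le0 yx).
Qed.

(** The norm is the sum of the b x * <b, alpha_x>, so one of these terms is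
    positive; this is the step that lowers the height of a positive root. *)
Lemma cform_gt0_simple b : (forall y, 0 <= b y) -> 0 < cform b b ->
  exists x, 0 < b x /\ 0 < cform b (alpha x).
Proof.
move=> b0 bb; have [|h] := pselect (exists x, 0 < b x /\ 0 < cform b (alpha x)) => //.
suff: cform b b <= 0 by rewrite leNgt bb.
rewrite cform_sumr sumr_le0 // => x _; have := b0 x; rewrite le_eqVlt.
case/predU1P => [<-|bx]; first by rewrite mul0r.
apply: mulr_ge0_le0 (b0 x) _; rewrite leNgt; apply/negP => cx.
by case: h; exists x.
Qed.

(** The form is symmetric with even diagonal.  Evenness rules out a norm 2
    vector whose positive and negative parts both have norm 1 ([norm2_sign]). *)
Lemma cform_even b : exists k, cform b b = 2 * k.
Proof.
pose f (x y : vertex t) : int := b x * b y * cartan x y.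
pose S : int := \sum_(x : vertex t) \sum_(y : vertex t) (x < y)%N%:R * f x y.
exists (S + \sum_x b x ^+ 2 : int).
have S' : \sum_(x : vertex t) \sum_(y : vertex t) (y < x)%N%:R * f x y = S.
  rewrite exchange_big; apply: eq_bigr => x _; apply: eq_bigr => y _ /=.
  by rewrite /f cartanC [b y * _]mulrC.
have D : \sum_x \sum_y (x == y)%:R * f x y = 2 * \sum_x b x ^+ 2 :> int.
  rewrite mulr_sumr; apply: eq_bigr => x _; rewrite (bigD1 x) //= eqxx big1.
    by rewrite /f cartanxx /=; ring.
  by move=> y; rewrite eq_sym => /negPf ->; rewrite mul0r.
rewrite mulrDr -D mulr_natl mulr2n -{2}S' -!big_split; apply: eq_bigr => x _.
rewrite -!big_split; apply: eq_bigr => y _; rewrite -val_eqE /=.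
by rewrite -/(f x y); case: ltngtP => _ /=; ring.
Qed.

End Form.

Section NullRoot.
Variables (t : affine_type) (delta : {ffun vertex t -> nat}).
Hypothesis hdelta : is_null_root delta.
Implicit Types (x y : vertex t) (b c e v : weight t).

Lemma mark0 : mark t 0 = 1%N.
Proof. by case: t. Qed.

(** The marks lie in the kernel of the Cartan matrix, hence are a rational
    multiple of delta.  As the mark at x0 is 1, the value of delta there divides
    every coefficient of delta, so it divides their gcd. *)
Lemma null_rootE x : delta x = mark t x.
Proof.
case: hdelta => gcd1 ker.
have [a ha] : exists a : rat, forall y, (mark t y)%:R = a * (delta y)%:R.
  apply/ker => y; have /(congr1 (intr : int -> rat)) := cartan_mark y.
  rewrite mulr0z raddf_sum /= => {2}<-; apply: eq_bigr => z _.
  by rewrite intrM pmulrn.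
have a0 : a * (delta x0)%:R = 1 by rewrite -ha /= mark0.
have dm y : delta y = (mark t y * delta x0)%N.
  apply/eqP; rewrite -(eqr_nat rat) natrM ha -mulrA [X in _ * X]mulrC mulrA a0.
  by rewrite mul1r.
have : (delta x0 %| \big[gcdn/0%N]_y delta y)%N.
  by apply/dvdn_biggcdP => y _; rewrite [X in (_ %| X)%N]dm dvdn_mull.
by rewrite gcd1 dvdn1 => /eqP d0; rewrite dm d0 muln1.
Qed.

Lemma null_root0 : delta x0 = 1%N.
Proof. by rewrite null_rootE /= mark0. Qed.

Lemma null_root_gt0 x : (0 < delta x)%N.
Proof.
rewrite null_rootE; case: t x => [n hn|n hn|||] x //=; first by case: ifP.
all: by case: x; do 9?[case=> //].
Qed.

Definition nullw : weight t := [ffun x => (delta x)%:Z].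

Lemma nullwE x : nullw x = (delta x)%:Z.
Proof. by rewrite ffunE. Qed.

Lemma cform_nullr b : cform b nullw = 0.
Proof.
rewrite /cform big1 // => x _; transitivity (b x * \sum_y cartan x y * (mark t y)%:Z).
  rewrite mulr_sumr; apply: eq_bigr => y _.
  by rewrite ffunE null_rootE -mulrA [X in _ * X]mulrC.
by rewrite cartan_mark mulr0.
Qed.

Lemma cform_nulll b : cform nullw b = 0.
Proof. by rewrite cformC cform_nullr. Qed.

Let dq x : rat := (delta x)%:R.
Let wq v x : rat := (v x)%:~R / dq x.

Let dq_gt0 x : 0 < dq x.
Proof. by rewrite ltr0n null_root_gt0. Qed.

Let dq_neq0 x : dq x != 0.
Proof. by rewrite gt_eqF. Qed.

Let wqK v x : wq v x * dq x = (v x)%:~R.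
Proof. by rewrite /wq divfK. Qed.

Let cartan_dq x : \sum_y (cartan x y)%:~R * dq y = 0.
Proof.
rewrite -[RHS](mulr0z (1 : rat)) -(cartan_mark x) [RHS]raddf_sum /=.
by apply: eq_bigr => y _; rewrite intrM /dq null_rootE pmulrn.
Qed.

(** Dividing the coordinates by those of delta diagonalizes the form: since delta
    is in the kernel, the square terms of the expansion on the right cancel. *)
Lemma cform_sum_squares v :
  2 * (cform v v)%:~R
  = \sum_x \sum_y - (cartan x y)%:~R * (dq x * dq y * (wq v x - wq v y) ^+ 2).
Proof.
pose Z1 := \sum_x \sum_y (cartan x y)%:~R * (dq x * dq y * wq v x ^+ 2).
pose Z2 := \sum_x \sum_y (cartan x y)%:~R * (dq x * dq y * wq v y ^+ 2).
have z1 : Z1 = 0.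
  rewrite /Z1 big1 // => x _; transitivity (dq x * wq v x ^+ 2 * \sum_y (cartan x y)%:~R * dq y).
    by rewrite mulr_sumr; apply: eq_bigr => y _; ring.
  by rewrite cartan_dq mulr0.
have z2 : Z2 = 0.
  rewrite /Z2 exchange_big -[RHS]z1; apply: eq_bigr => x _; apply: eq_bigr => y _ /=.
  by rewrite cartanC; ring.
have -> : (cform v v)%:~R
    = \sum_x \sum_y (cartan x y)%:~R * (dq x * dq y * (wq v x * wq v y)) :> rat.
  rewrite raddf_sum; apply: eq_bigr => x _; rewrite raddf_sum; apply: eq_bigr => y _ /=.
  by rewrite !intrM -!wqK; ring.
rewrite -[LHS]subr0 -[X in _ - X]addr0 -[X in _ - (X + _)]z1 -[X in _ - (_ + X)]z2.
rewrite /Z1 /Z2 mulr_sumr -!big_split -sumrB.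
apply: eq_bigr => x _; rewrite mulr_sumr -!big_split -sumrB.
by apply: eq_bigr => y _ /=; ring.
Qed.

Let square_ge0 v x y :
  0 <= - (cartan x y)%:~R * (dq x * dq y * (wq v x - wq v y) ^+ 2).
Proof.
have [->|xy] := eqVneq x y; first by rewrite subrr expr0n /= !mulr0.
rewrite mulr_ge0 //; first by rewrite oppr_ge0 lerz0 cartan_le0.
by rewrite mulr_ge0 ?sqr_ge0 // mulr_ge0 // ltW.
Qed.

Lemma cform_ge0 v : 0 <= cform v v.
Proof.
rewrite -(ler0z rat) -(pmulr_rge0 _ (ltr0Sn rat 1)) cform_sum_squares.
by rewrite sumr_ge0 // => x _; rewrite sumr_ge0.
Qed.

(** In norm 0 all the squares vanish, so that v / delta takes the same value on
    adjacent vertices.  Then v is in the kernel of the Cartan matrix, and its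
    multiple of delta is read off at x0, where delta is 1. *)
Lemma cform_eq0 v : cform v v = 0 -> v = nullw *~ v x0.
Proof.
move=> v0; have sq x y : (cartan x y)%:~R * (wq v x - wq v y) = 0.
  have h0 : \sum_x \sum_y - (cartan x y)%:~R * (dq x * dq y * (wq v x - wq v y) ^+ 2) = 0.
    by rewrite -cform_sum_squares v0 mulr0.
  have := psumr_eq0P _ h0 => /(_ (fun x _ => sumr_ge0 _ (fun y _ => square_ge0 v x y))).
  move=> /(_ x isT) /psumr_eq0P => /(_ (fun y _ => square_ge0 v x y)) /(_ y isT).
  move/eqP; rewrite mulf_eq0 oppr_eq0 !mulf_eq0 !(negPf (dq_neq0 _)) /= orbb.
  by case/orP => /eqP ->; rewrite ?mul0r ?mulr0.
case: hdelta => _ /(_ (fun x => (v x)%:~R)) [ker _].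
have [|a ha] := ker.
  move=> x; transitivity (\sum_y (wq v x * ((cartan x y)%:~R * dq y)
      - dq y * ((cartan x y)%:~R * (wq v x - wq v y)))).
    by apply: eq_bigr => y _; rewrite -wqK; ring.
  rewrite sumrB -mulr_sumr cartan_dq mulr0 add0r big1 ?oppr0 // => y _.
  by rewrite sq mulr0.
have a0 : a = (v x0)%:~R by rewrite ha null_root0 mulr1.
apply/ffunP => x; apply: (@intr_inj rat); rewrite ha a0.
by rewrite ffunMzE ffunE mulrzz intrM mulrC pmulrn.
Qed.

Lemma cform_eq0_finite v : cform v v = 0 -> v x0 = 0 -> v = 0.
Proof. by move=> /cform_eq0 E v0; rewrite E v0 mulr0z. Qed.

Lemma other_vertex x : exists y, y != x.
Proof.
have h : (1 < (affine_rank t).+1)%N by case: t => //= n; lia.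
have [->|x1] := eqVneq x x0; first by exists (Ordinal h).
by exists x0; rewrite eq_sym.
Qed.

Lemma root0_norm b : root0 b -> b x0 = 0 /\ cform b b = 2.
Proof.
elim=> {b} [x xn0|x b xn0 _ [b0 bb]].
  by rewrite ffunE eq_sym (negPf xn0) cform_alpha cartanxx.
rewrite reflectionE; split.
  by rewrite !ffunE ffunMzE ffunE b0 eq_sym (negPf xn0) mul0rz subrr.
rewrite !(cformE, cformMzl, cformMzr) bb [cform (alpha x) b]cformC; ring.
Qed.

Lemma root0N b : root0 b -> root0 (- b).
Proof.
elim=> {b} [x xn0|x b xn0 _ rb].
  have -> : - alpha x = reflection x (alpha x); last exact: Root_reflection (Root_simple _).
  by apply/ffunP => y; rewrite !(ffunE, ffunMzE) cform_alpha cartanxx mulrzz; ring.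
have -> : - reflection x b = reflection x (- b); last exact: Root_reflection.
by rewrite !reflectionE opprB cformNl mulrNz opprK addrC.
Qed.

Lemma cform_sub_simple b x : cform b b = 2 ->
  cform (b - alpha x) (b - alpha x) = 4 - 2 * cform b (alpha x).
Proof. by move=> bb; rewrite !cformE bb [cform (alpha x) b]cformC; ring. Qed.

Lemma norm2_cform_simple_le2 b x : cform b b = 2 -> cform b (alpha x) <= 2.
Proof. by move=> /(@cform_sub_simple b x); have := cform_ge0 (b - alpha x); lia. Qed.

(** Induction on the height: subtracting a simple root x with <b, alpha_x> = 1 is
    the reflection at x, and <b, alpha_x> = 2 leaves a vector of norm 0. *)
Lemma pos_norm2_root0 b : (forall x, 0 <= b x) -> b x0 = 0 -> cform b b = 2 -> root0 b.
Proof.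
have [n] : exists n, (height b <= n%:Z) by exists (absz (height b)); lia.
elim: n b => [|n IHn] b hn b0 bx0 bb.
  have bz : b = 0.
    apply/ffunP => x; rewrite ffunE; apply/eqP; rewrite eq_le b0 andbT.
    by apply: le_trans hn; exact: height_ge.
  by move: bb; rewrite bz -(mulr0z (alpha x0)) cformMzl mul0r.
have [||x [bx cx]] := @cform_gt0_simple t b; [by []|by rewrite bb|].
have xn0 : x != x0 by apply/eqP => e; rewrite e bx0 in bx.
have c2 := norm2_cform_simple_le2 x bb.
have [c2e|c1] : cform b (alpha x) = 2 \/ cform b (alpha x) = 1 by lia.
  suff -> : b = alpha x by exact: Root_simple.
  apply/eqP; rewrite -subr_eq0; apply/eqP/cform_eq0_finite.
    by rewrite cform_sub_simple // c2e.
  by rewrite !ffunE bx0 eq_sym (negPf xn0) subrr.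
have c' : cform (b - alpha x) (alpha x) = -1 by rewrite !cformE c1.
have -> : b = reflection x (b - alpha x).
  by rewrite reflectionE c' mulrN1z opprK subrK.
apply: Root_reflection => //; apply: IHn.
- by rewrite heightB; lia.
- move=> y; rewrite !ffunE; case: eqP => [->|_]; first by rewrite subr_ge0 -gtz0_ge1.
  by rewrite subr0.
- by rewrite !ffunE bx0 eq_sym (negPf xn0) subrr.
- by rewrite cform_sub_simple // c1.
Qed.

(** If p and q are the positive and negative parts, then <p, q> <= 0 and
    2 = <p, p> + <q, q> - 2 <p, q>.  The norms of p and q are even and
    nonnegative, so that one of them is 0. *)
Lemma norm2_sign b : b x0 = 0 -> cform b b = 2 ->
  (forall x, 0 <= b x) \/ (forall x, b x <= 0).
Proof.
move=> bx0 bb; pose p : weight t := [ffun x => Num.max (b x) 0].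
pose q : weight t := [ffun x => Num.max (- b x) 0].
have pE x : p x = Num.max (b x) 0 by rewrite ffunE.
have qE x : q x = Num.max (- b x) 0 by rewrite ffunE.
have maxE (z : int) : z = Num.max z 0 - Num.max (- z) 0.
  by case: lerP => ?; case: lerP => ?; lia.
have bE : b = p - q by apply/ffunP => x; rewrite !ffunE; exact: maxE.
have pq : cform p q <= 0.
  apply: sumr_le0 => x _; apply: sumr_le0 => y _; rewrite pE qE.
  have [->|/cartan_le0 c0] := eqVneq x y.
    by rewrite (_ : _ * _ = 0) ?mul0r //; case: lerP => ?; case: lerP => ?; lia.
  by rewrite mulr_ge0_le0 // mulr_ge0 // le_max lexx orbT.
have pp := cform_ge0 p; have qq := cform_ge0 q.
have [i pi] := cform_even p; have [j qj] := cform_even q.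
have : cform b b = cform p p + cform q q - 2 * cform p q.
  by rewrite bE !cformE [cform q p]cformC; ring.
rewrite bb => E.
have [p0|q0] : cform p p = 0 \/ cform q q = 0 by lia.
- right => x; have := cform_eq0_finite p0; rewrite pE bx0 maxxx => /(_ erefl) pz.
  by have := pE x; rewrite pz ffunE; case: lerP => // + e; rewrite -e ltxx.
- left => x; have := cform_eq0_finite q0; rewrite qE bx0 oppr0 maxxx => /(_ erefl) qz.
  by have := qE x; rewrite qz ffunE -oppr_le0; case: lerP => // + e; rewrite -e ltxx.
Qed.

(** Membership in the Weyl orbit becomes a computation with the form. *)
Lemma root0P b : root0 b <-> b x0 = 0 /\ cform b b = 2.
Proof.
split=> [/root0_norm //|[bx0 bb]]; have [b0|b0] := norm2_sign bx0 bb.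
  exact: pos_norm2_root0.
rewrite -[b]opprK; apply/root0N/pos_norm2_root0; rewrite ?cformE ?bb //.
  by move=> x; rewrite ffunE oppr_ge0.
by rewrite ffunE bx0 oppr0.
Qed.

End NullRoot.

(** * Vectors of norm 2 between zero and the null root *)

Section Short.
Variables (t : affine_type) (delta : {ffun vertex t -> nat}).
Hypothesis hdelta : is_null_root delta.
Implicit Types (x y : vertex t) (b c : weight t).

Let d0 := null_root0 hdelta.
Let dgt0 := null_root_gt0 hdelta.
Local Notation nullw := (nullw delta).

(** The weights of the semidirect product other than delta.  The description
    does not distinguish x0 and is stable under c |-> delta - c. *)
Definition short_root b : Prop :=
  (forall x, 0 <= b x <= (delta x)%:Z) /\ cform b b = 2.

Lemma short_ge0 b x : short_root b -> 0 <= b x.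
Proof. by case=> /(_ x) /andP[]. Qed.

Lemma short_simple x : short_root (alpha x).
Proof.
split=> [y|]; last by rewrite cform_alpha cartanxx.
by rewrite weight_alpha; have := dgt0 y; case: eqP => _ /=; lia.
Qed.

Lemma short_compl b : short_root b -> short_root (nullw - b).
Proof.
case=> b0 bb; split=> [x|]; first by have := b0 x; rewrite !(weightE, nullwE); lia.
by rewrite !cformE !cform_nullr // !cform_nulll // bb; ring.
Qed.

Lemma short_le2 b x : short_root b -> cform b (alpha x) <= 2.
Proof. by by case=> _; exact: (norm2_cform_simple_le2 hdelta). Qed.

(** Here b - alpha_x is a multiple k delta.  Comparing coordinates at x and at
    another vertex with the bounds 0 and delta forces k = 0. *)
Lemma short_eq2 b x : short_root b -> cform b (alpha x) = 2 -> b = alpha x.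
Proof.
move=> [b0 bb] c2; have nb : cform (b - alpha x) (b - alpha x) = 0.
  by rewrite cform_sub_simple // c2.
have E := cform_eq0 hdelta nb; set k := (b - alpha x) x0 in E.
have kE y : b y = (y == x)%:Z + (delta y)%:Z * k.
  by have /ffunP/(_ y) := E; rewrite !(weightE, nullwE) => <-; rewrite addrC subrK.
suff k0 : k = 0 by apply/ffunP => y; rewrite kE k0 mulr0 addr0 weight_alpha.
have [y /negPf yx] := other_vertex x.
have := b0 y; have := b0 x; rewrite !kE eqxx yx /= add0r.
(* for k >= 1 the bound delta fails at x, and for k < 0 the bound 0 fails at y *)
have := dgt0 x; have := dgt0 y; nia.
Qed.

Lemma short_ge1_pos b x : short_root b -> 0 < cform b (alpha x) -> 0 < b x.
Proof.
move=> [b0 _] c1; have /andP[] := b0 x; rewrite le_eqVlt => /predU1P[e|//] _.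
suff : cform b (alpha x) <= 0 by rewrite leNgt c1.
by apply: cform_alpha_le0 => // y; case/andP: (b0 y).
Qed.

Lemma short_sub b x : short_root b -> cform b (alpha x) = 1 -> short_root (b - alpha x).
Proof.
move=> sb c1; have bx := @short_ge1_pos b x sb; rewrite c1 in bx.
case: sb => b0 bb; split=> [y|]; last by rewrite cform_sub_simple // c1.
rewrite !(weightE, nullwE); have := b0 y; case: eqP => [->|_]; last by rewrite subr0.
by have := bx isT; rewrite /=; lia.
Qed.

(** This is [short_sub] for delta - b: no short root leaves the interval
    from 0 to delta by adding a simple root at product -1. *)
Lemma short_add b x : short_root b -> cform b (alpha x) = -1 -> short_root (b + alpha x).
Proof.
move=> sb c1; have -> : b + alpha x = nullw - (nullw - b - alpha x).
    by apply/ffunP => y; rewrite !weightE; ring.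
apply/short_compl/short_sub; first exact: short_compl.
by rewrite !cformE cform_nulll // c1.
Qed.

Lemma short_geN2 b x : short_root b -> -2 <= cform b (alpha x).
Proof.
move=> sb; have := short_le2 x (short_compl sb).
by rewrite !cformE cform_nulll //; lia.
Qed.

Lemma short_eqN2 b x : short_root b -> cform b (alpha x) = -2 -> b + alpha x = nullw.
Proof.
move=> sb c2; rewrite -(@short_eq2 (nullw - b) x); first by rewrite addrC subrK.
  exact: short_compl.
by rewrite !cformE cform_nulll // c2.
Qed.

Lemma short_descent b : short_root b ->
  exists x, b = alpha x \/ cform b (alpha x) = 1 /\ short_root (b - alpha x).
Proof.
move=> sb; have [||x [bx cx]] := @cform_gt0_simple t b.
- by move=> x; exact: short_ge0.
- by case: sb => _ ->.
exists x; have := short_le2 x sb => c2.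
have [c2e|c1] : cform b (alpha x) = 2 \/ cform b (alpha x) = 1 by lia.
  by left; exact: short_eq2.
by right; split=> //; exact: short_sub.
Qed.

Lemma short_height b : short_root b -> 0 < height b.
Proof.
move=> sb; have b0 x := short_ge0 x sb; have [||x [bx _]] := @cform_gt0_simple t b => //.
  by case: sb => _ ->.
exact: lt_le_trans bx (height_ge x b0).
Qed.

(** A short root that is not simple has product 1 with some alpha_x, so that
    subtracting alpha_x leaves a short root of smaller height. *)
Lemma short_ind (P : weight t -> Prop) :
  (forall x, P (alpha x)) ->
  (forall b x, short_root b -> short_root (b + alpha x) ->
     cform b (alpha x) = -1 -> P b -> P (b + alpha x)) ->
  forall b, short_root b -> P b.
Proof.
move=> P0 PS b; have [n] : exists n, (height b <= n%:Z).
  by exists (absz (height b)); lia.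
elim: n b => [|n IHn] b hn sb; first by have := short_height sb; lia.
have [x [->//|[c1 s1]]] := short_descent sb.
rewrite -[b](subrK (alpha x)); apply: PS => //; first by rewrite subrK.
  by rewrite !cformE c1.
by apply: IHn => //; rewrite heightB; lia.
Qed.

Variables (theta : weight t) (htheta : lowest_root theta).

(** The weight alpha_x0 - delta is a root with nonpositive products with all
    alpha_x for x other than x0.  As theta is below it, the product of the two is
    at least 2, so their difference has norm at most 0. *)
Lemma lowest_rootE : theta = alpha x0 - nullw.
Proof.
have [[rt _] low] := htheta.
have rt' : root0 (alpha x0 - nullw).
  apply/(root0P hdelta); rewrite !(weightE, nullwE) eqxx d0 !cformE cform_nullr // cform_nulll //.
  by rewrite cform_nulll // subrr.
have [t0 tt] := root0_norm rt.
have le2 : 2 <= cform theta (alpha x0 - nullw).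
  have E : cform (alpha x0 - nullw - theta) (alpha x0 - nullw) <= 0.
    rewrite cformDr cformNr cform_nullr // subr0 cform_alpha_le0 //.
      by move=> x; have := low _ rt' x; rewrite !(weightE, nullwE); lia.
    by rewrite !(weightE, nullwE) t0 d0 eqxx.
  move: E; have [_ E] := root0_norm rt'; rewrite cformDl cformNl E; lia.
apply/eqP; rewrite -subr_eq0; apply/eqP; apply: (cform_eq0_finite hdelta).
  have := cform_ge0 hdelta (theta - (alpha x0 - nullw)).
  have [_ E] := root0_norm rt'.
  rewrite !(cformDl _ (- (alpha x0 - nullw))) !(cformDr _ (- (alpha x0 - nullw))).
  rewrite !(cformNl (alpha x0 - nullw)) !(cformNr (alpha x0 - nullw)) E tt.
  by rewrite [cform (alpha x0 - nullw) theta]cformC; lia.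
by rewrite !(weightE, nullwE) t0 d0 subrr.
Qed.

Lemma root0_nullD b : root0 b -> short_root b \/ short_root (nullw + b).
Proof.
have [_ low] := htheta; move=> rb; have [b0 bb] := root0_norm rb.
have [bp|bn] := norm2_sign hdelta b0 bb.
  left; split=> // x; rewrite bp /=; have := low _ (root0N rb) x.
  by rewrite lowest_rootE !(weightE, nullwE); case: eqP => _ /=; lia.
right; split; last by rewrite !cformE !cform_nullr // cform_nulll // bb.
move=> x; rewrite !(weightE, nullwE); have := low _ rb x; have := bn x.
by rewrite lowest_rootE !(weightE, nullwE); case: eqP => _ /=; lia.
Qed.

End Short.

(** * Linear spans and signs *)
Local Open Scope classical_set_scope.

Section SpanTheory.
Variables (K : fieldType) (V : lmodType K) (S : set V).

Lemma span0 : span S 0.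
Proof. by have [[/asboolP h _] _] := span_closed S. Qed.

Lemma spanD u v : span S u -> span S v -> span S (u + v).
Proof.
have [[_ h] _] := span_closed S => Su Sv.
by apply/asboolP/h; apply/asboolP.
Qed.

Lemma spanZ a v : span S v -> span S (a *: v).
Proof. by have [_ h] := span_closed S => Sv; apply/asboolP/h/asboolP. Qed.

Lemma spanN v : span S v -> span S (- v).
Proof. by rewrite -scaleN1r; exact: spanZ. Qed.

Lemma spanB u v : span S u -> span S v -> span S (u - v).
Proof. by move=> Su /spanN; exact: spanD. Qed.

Lemma span_elim (P : V -> Prop) :
  P 0 -> (forall u v, P u -> P v -> P (u + v)) -> (forall a v, P v -> P (a *: v)) ->
  (forall v, S v -> P v) -> forall v, span S v -> P v.
Proof.
move=> P0 PD PZ PS _ [s Ss ->]; rewrite big_seq.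
by elim/big_rec: _ => // p v ps Pv; apply: PD => //; apply/PZ/PS/Ss.
Qed.

End SpanTheory.

Section LinearMap.
Variables (K : fieldType) (V W : lmodType K) (f : V -> W).
Hypothesis lf : linear f.

Lemma linear_map0 : f 0 = 0.
Proof. by have := lf (-1) 0 0; rewrite scaler0 addr0 scaleN1r addNr. Qed.

Lemma linear_mapZ a v : f (a *: v) = a *: f v.
Proof. by rewrite -[a *: v]addr0 lf linear_map0 addr0. Qed.

Lemma linear_mapD u v : f (u + v) = f u + f v.
Proof. by rewrite -{1}[u]scale1r lf scale1r. Qed.

Lemma linear_mapN v : f (- v) = - f v.
Proof. by rewrite -scaleN1r linear_mapZ scaleN1r. Qed.

End LinearMap.

Lemma span_linear (K : fieldType) (V W : lmodType K) (S : set V) (T : set W)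
    (f : V -> W) : linear f -> (forall v, S v -> span T (f v)) ->
  forall v, span S v -> span T (f v).
Proof.
move=> lf ST.
apply: (span_elim (P := fun v => span T (f v))) => // [|u v Tu Tv|a v Tv].
- by rewrite linear_map0 //; exact: span0.
- by rewrite linear_mapD //; exact: spanD.
- by rewrite linear_mapZ //; exact: spanZ.
Qed.

Lemma span_sub (K : fieldType) (V : lmodType K) (S T : set V) :
  (forall v, S v -> T v) -> forall v, span S v -> span T v.
Proof. by move=> ST; apply: (span_linear (f := id)) => // v /ST; exact: span_incl. Qed.

(** Structure constants and values of monomials are only determined up to sign. *)
Definition eq_sign (V : zmodType) (u v : V) : Prop := u = v \/ u = - v.

Lemma eq_sign_trans (V : zmodType) (u v w : V) :
  eq_sign u v -> eq_sign v w -> eq_sign u w.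
Proof.
by case=> -> [] ->; rewrite /eq_sign ?opprK; [left|right|right|left].
Qed.

Lemma eq_sign_sym (V : zmodType) (u v : V) : eq_sign u v -> eq_sign v u.
Proof. by case=> ->; rewrite /eq_sign ?opprK; [left|right]. Qed.

Lemma eq_sign_lie (K : fieldType) (L : lieAlgType K) (z u v : L) :
  eq_sign u v -> eq_sign (lie z u) (lie z v).
Proof. by case=> ->; rewrite ?lieNr; [left|right]. Qed.

Lemma eq_sign0 (V : zmodType) (u : V) : eq_sign u 0 -> u = 0.
Proof. by case=> ->; rewrite ?oppr0. Qed.

Lemma span_sign (K : fieldType) (V : lmodType K) (S : set V) u v :
  eq_sign u v -> S v -> span S u.
Proof. by case=> -> Sv; [|apply: spanN]; exact: span_incl. Qed.

Lemma lie_bracketl (K : fieldType) (L : lieAlgType K) (x y z : L) :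
  lie (lie x y) z = lie x (lie y z) - lie y (lie x z).
Proof. by rewrite lie_derivation addrK. Qed.

(** * Monomials in sandwich generators *)

Section Sandwich.
Variables (t : affine_type) (delta : {ffun vertex t -> nat}).
Hypothesis hdelta : is_null_root delta.
Variables (K : fieldType) (charK : 2%N \notin [pchar K]) (L : lieAlgType K).
Variable gen : vertex t -> L.
Hypothesis gen_comm : forall x y, cartan x y = 0 -> lie (gen x) (gen y) = 0.
Hypothesis gen_sandwich : forall x u, lie (gen x) (lie (gen x) u) = 0.
Implicit Types (x y : vertex t) (b c : weight t) (u v w : L).

Local Notation nullw := (nullw delta).
Local Notation short_root := (short_root delta).

(** Expanding [[x, [x, u]], v] = 0 gives -2 [x, [u, [x, v]]] = 0; this is where
    the characteristic is used. *)
Lemma sandwich_middle x u v : lie (gen x) (lie u (lie (gen x) v)) = 0.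
Proof.
set w := lie (gen x) _.
have : lie (lie (gen x) (lie (gen x) u)) v = 0 by rewrite gen_sandwich lie0l.
rewrite lie_bracketl !(lie_bracketl (gen x) u) lieDr lieNr !gen_sandwich lie0r.
rewrite -/w subr0 add0r -opprD => /eqP; rewrite oppr_eq0 -mulr2n -scaler_nat.
rewrite scaler_eq0 => /orP[|/eqP //].
by move: charK; rewrite !inE /= => /negPf ->.
Qed.

(** Keeping all partial weights among the short roots makes the value of a
    monomial unique up to sign and its image in the semidirect product nonzero. *)
Inductive root_mono : weight t -> L -> Prop :=
| Real_gen x : root_mono (alpha x) (gen x)
| Real_step b x u of root_mono b u & short_root (b + alpha x) :
    root_mono (b + alpha x) (lie (gen x) u).

Lemma root_mono_short b u : root_mono b u -> short_root b.
Proof. by case=> // x; exact: short_simple. Qed.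

Lemma root_mono_cform b x u :
  root_mono b u -> short_root (b + alpha x) -> cform b (alpha x) = -1.
Proof.
move=> /root_mono_short[_ bb] [_]; rewrite !cformE bb [cform (alpha x) b]cformC.
by lia.
Qed.

Lemma root_mono_ex b : short_root b -> exists u, root_mono b u.
Proof.
move: b; apply: (short_ind hdelta) => [x|b x _ sbx _ [u Mu]].
  by exists (gen x); exact: Real_gen.
by exists (lie (gen x) u); exact: Real_step.
Qed.

Lemma root_mono_inv b u : root_mono b u ->
  (exists2 x, b = alpha x & u = gen x) \/
  exists x v, [/\ root_mono (b - alpha x) v, cform b (alpha x) = 1 & u = lie (gen x) v].
Proof.
case=> [x|{}b x {}u Mu sbx]; first by left; exists x.
right; exists x, u; rewrite addrK; split=> //.
by rewrite !cformE (root_mono_cform Mu sbx).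
Qed.

Lemma root_mono_lie b x u :
  root_mono (b - alpha x) u -> short_root b -> root_mono b (lie (gen x) u).
Proof. by rewrite -{2 3}[b](subrK (alpha x)); exact: Real_step. Qed.

Lemma alpha_inj : injective (@alpha t).
Proof.
move=> x y /ffunP/(_ x); rewrite !ffunE eqxx; by case: eqP.
Qed.

Lemma root_mono_simple x u : root_mono (alpha x) u -> u = gen x.
Proof.
case/root_mono_inv=> [[y /alpha_inj <- //]|[y [v [_ + _]]]].
by rewrite cform_alpha /cartan; case: ifP => // _; case: ifP.
Qed.

Lemma cartan_cases x y : [\/ x = y, cartan x y = 0 | cartan x y = -1].
Proof.
rewrite /cartan; case: eqP => [->|_]; first by constructor 1.
by case: ifP => _; [constructor 3|constructor 2].
Qed.

Lemma lie_gen_swap x y u : cartan x y = 0 ->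
  lie (gen x) (lie (gen y) u) = lie (gen y) (lie (gen x) u).
Proof. by move=> c0; rewrite lie_derivation gen_comm // lie0l add0r. Qed.

(** The two claims support each other in the induction.  Uniqueness: compare the outermost
    generators x and y of u and v.  If they are orthogonal, both monomials come
    from one of weight b - alpha_x - alpha_y and x, y commute; if they are
    adjacent, then b = alpha_x + alpha_y.  Vanishing: if <b, alpha_x> = 1,
    uniqueness allows u = [x, w], killed by x; if the product is 0, write
    u = [y, u'] and either move x past y or, for adjacent x and y, use
    u' = [x, w] and [x, [y, [x, w]]] = 0. *)
Lemma root_mono_main b u : root_mono b u ->
  (forall v, root_mono b v -> eq_sign u v) /\
  (forall x, 0 <= cform b (alpha x) -> lie (gen x) u = 0).
Proof.
have [n] : exists n, (height b <= n%:Z) by exists (absz (height b)); lia.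
elim: n b u => [|n IHn] b u hn Mu.
  by have := short_height (root_mono_short Mu); lia.
have sb := root_mono_short Mu.
have sub x : short_root b -> cform b (alpha x) = 1 -> short_root (b - alpha x).
  exact: short_sub.
have hs x : height (b - alpha x) <= n%:Z by rewrite heightB; lia.
have uniq v : root_mono b v -> eq_sign u v.
  move=> Mv; have [[x bE uE]|[x [u' [Mu' cx uE]]]] := root_mono_inv Mu.
    by left; rewrite uE; apply/esym/root_mono_simple; rewrite -bE.
  have [[y bE vE]|[y [v' [Mv' cy vE]]]] := root_mono_inv Mv.
    by left; rewrite vE; apply/root_mono_simple; rewrite -bE.
  have [U _] := IHn _ _ (hs x) Mu'; have [V _] := IHn _ _ (hs y) Mv'.
  rewrite uE vE; have [exy|cxy|cxy] := cartan_cases x y.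
  - by rewrite exy in U *; apply/eq_sign_lie/U.
  - have cy' : cform (b - alpha x) (alpha y) = 1 by rewrite !cformE cy cxy.
    have cx' : cform (b - alpha y) (alpha x) = 1 by rewrite !cformE cx cartanC cxy.
    have sx := root_mono_short Mu'; have sy := root_mono_short Mv'.
    have [w Mw] := root_mono_ex (short_sub hdelta sx cy').
    have Mw' := Mw; rewrite addrAC in Mw'.
    have Uw := U _ (root_mono_lie Mw sx); have Vw := V _ (root_mono_lie Mw' sy).
    apply: (eq_sign_trans (eq_sign_lie (gen x) Uw)); rewrite lie_gen_swap //.
    exact/eq_sign_sym/eq_sign_lie.
  - have cy' : cform (b - alpha x) (alpha y) = 2 by rewrite !cformE cy cxy.
    have ey := short_eq2 hdelta (root_mono_short Mu') cy'.
    have ex : b - alpha y = alpha x by rewrite -ey subKr.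
    rewrite ey in Mu'; rewrite ex in Mv'.
    by rewrite (root_mono_simple Mu') (root_mono_simple Mv'); right; rewrite lieC.
split=> // x c0; have c2 := short_le2 hdelta x sb.
have [ce|ce|ce] : [\/ cform b (alpha x) = 2, cform b (alpha x) = 1 | cform b (alpha x) = 0].
- have [|[]] : cform b (alpha x) = 2 \/ cform b (alpha x) = 1 \/ cform b (alpha x) = 0 by lia.
  + by constructor 1.
  + by constructor 2.
  + by constructor 3.
- have bx := short_eq2 hdelta sb ce; rewrite bx in Mu.
  by rewrite (root_mono_simple Mu) liexx.
- have [w Mw] := root_mono_ex (sub x sb ce).
  apply: eq_sign0; rewrite -[X in eq_sign _ X](gen_sandwich x w).
  exact/eq_sign_lie/uniq/root_mono_lie.
have [[y bE ->]|[y [u' [Mu' cy ->]]]] := root_mono_inv Mu.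
  by apply: gen_comm; rewrite cartanC -cform_alpha -bE.
have [exy|cxy|cxy] := cartan_cases x y; first by rewrite exy cy in ce.
- have [_ Z] := IHn _ _ (hs y) Mu'.
  by rewrite lie_gen_swap // Z ?lie0r // !cformE ce cartanC cxy.
- have cx' : cform (b - alpha y) (alpha x) = 1 by rewrite !cformE ce cartanC cxy.
  have sy := root_mono_short Mu'.
  have [w Mw] := root_mono_ex (short_sub hdelta sy cx').
  have [U _] := IHn _ _ (hs y) Mu'.
  apply: eq_sign0; rewrite -[X in eq_sign _ X](sandwich_middle x (gen y) w).
  exact/eq_sign_lie/eq_sign_lie/U/root_mono_lie.
Qed.

Lemma root_mono_uniq b u v : root_mono b u -> root_mono b v -> eq_sign u v.
Proof. by move=> /root_mono_main[U _]; exact: U. Qed.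

Lemma root_mono_lie0 b x u : root_mono b u -> 0 <= cform b (alpha x) ->
  lie (gen x) u = 0.
Proof. by move=> /root_mono_main[_ Z]; exact: Z. Qed.

(** The elements of weight delta: products <c, alpha_x> = -2. *)
Definition null_mono x : set L :=
  [set h | exists2 u, root_mono (nullw - alpha x) u & h = lie (gen x) u].

Definition spanning_mono b : set L :=
  [set u | root_mono b u \/ b = nullw /\ exists x, null_mono x u].

(** For x = y this is the sandwich identity.  Otherwise delta - alpha_y has
    product 0 or 1 with alpha_x, and the argument is the one for products 0 in
    [root_mono_main]. *)
Lemma null_mono_lie0 x y h : null_mono y h -> lie (gen x) h = 0.
Proof.
case=> u Mu ->; have [->|cxy|cxy] := cartan_cases x y; first exact: gen_sandwich.
- rewrite lie_gen_swap // (root_mono_lie0 Mu) ?lie0r //.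
  by rewrite !cformE cform_nulll // cartanC cxy.
- have cx' : cform (nullw - alpha y) (alpha x) = 1.
    by rewrite !cformE cform_nulll // cartanC cxy.
  have [w Mw] := root_mono_ex (short_sub hdelta (root_mono_short Mu) cx').
  have Uw := root_mono_uniq Mu (root_mono_lie Mw (root_mono_short Mu)).
  apply: eq_sign0; rewrite -[X in eq_sign _ X](sandwich_middle x (gen y) w).
  exact/eq_sign_lie/eq_sign_lie.
Qed.

Lemma spanning_mono_lie_gen b x u :
  spanning_mono b u -> span (spanning_mono (b + alpha x)) (lie (gen x) u).
Proof.
case=> [Mu|[_ [y /null_mono_lie0 ->]]]; last exact: span0.
have sb := root_mono_short Mu; have := short_geN2 hdelta x sb.
have [c0 _|c0 cN2] := lerP 0 (cform b (alpha x)).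
  by rewrite (root_mono_lie0 Mu c0); exact: span0.
have [c1|c2] : cform b (alpha x) = -1 \/ cform b (alpha x) = -2 by lia.
  by apply: span_incl; left; apply: Real_step => //; exact: short_add.
apply: span_incl; right; have bE := short_eqN2 hdelta sb c2; split=> //.
by exists x, u => //; rewrite -bE addrK.
Qed.

Lemma span_spanning_mono_lie_gen b x u :
  span (spanning_mono b) u -> span (spanning_mono (b + alpha x)) (lie (gen x) u).
Proof.
by apply: (span_linear (lie_linearr _)) => v; exact: spanning_mono_lie_gen.
Qed.

Lemma root_mono_lie_span b c u v :
  root_mono b u -> span (spanning_mono c) v -> span (spanning_mono (b + c)) (lie u v).
Proof.
move=> Mu; elim: Mu c v => {b u} [x|b x u Mu IH _] c v Wv.
  by rewrite addrC; exact: span_spanning_mono_lie_gen.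
rewrite lie_bracketl; apply: spanB; last first.
  by rewrite -addrA [_ + c]addrC; apply/IH/span_spanning_mono_lie_gen.
by rewrite addrAC; apply/span_spanning_mono_lie_gen/IH.
Qed.

Lemma span_spanning_mono_lie b c u v :
  span (spanning_mono b) u -> span (spanning_mono c) v -> span (spanning_mono (b + c)) (lie u v).
Proof.
move=> + Wv; apply: (span_linear (lie_linearl v)) => w.
case=> [Mw|[-> [x [u' Mu' ->]]]]; first exact: root_mono_lie_span.
have -> : nullw + c = nullw - alpha x + c + alpha x by rewrite addrAC subrK.
rewrite lie_bracketl; apply: spanB; first exact/span_spanning_mono_lie_gen/root_mono_lie_span.
by rewrite -addrA; apply/root_mono_lie_span => //; exact: span_spanning_mono_lie_gen.
Qed.

(** Moving the generators of u to v one at a time, [[x, u], v] becomes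
    [x, [u, v]] - [u, [x, v]].  In the first term [u, v] has weight
    delta - alpha_x; the second is covered by induction. *)
Lemma root_mono_compl b u v : root_mono b u -> root_mono (nullw - b) v ->
  span [set h | exists2 x, 0 < b x & null_mono x h] (lie u v).
Proof.
move=> Mu; elim: Mu v => {b u} [x v Mv|b x u Mu IH sbx v Mv].
  by apply: span_incl; exists x; [rewrite weight_alpha eqxx|exists v].
have b0 y := short_ge0 y (root_mono_short Mu).
rewrite lie_bracketl; apply: spanB.
  have : span (spanning_mono (nullw - alpha x)) (lie u v).
    have -> : nullw - alpha x = b + (nullw - (b + alpha x)).
      by rewrite opprD addrCA addrA addrA addrK.
    by apply: root_mono_lie_span => //; apply: span_incl; left.
  apply: (span_linear (lie_linearr (gen x))) => w.
  case=> [Mw|[e _]].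
    apply: span_incl; exists x; last by exists w.
    by rewrite weightD weight_alpha eqxx; have := b0 x; lia.
  by have /= := congr1 (fun f : weight t => f x) e; rewrite !weightE eqxx; lia.
have c1 := root_mono_cform Mu sbx.
have : root_mono (nullw - b) (lie (gen x) v).
  apply: root_mono_lie; last by apply: short_compl => //; exact: root_mono_short Mu.
  by rewrite -addrA -opprD.
move/IH; apply: span_sub => h [y by0 Ny]; exists y => //.
by rewrite weightD weight_alpha; case: eqP => _ /=; lia.
Qed.

(** The element at x0 is [x0, u] with u of weight delta - alpha_x0.  Seen from u,
    it is a bracket of complementary monomials, and x0 is not in the support of
    the weight of u because delta x0 = 1. *)
Lemma null_mono_span h : spanning_mono nullw h ->
  span [set h | exists2 x, x != x0 & null_mono x h] h.
Proof.
case=> [/root_mono_short[_]|[_ [x Nx]]]; first by rewrite cform_nullr.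
have [ex|xn0] := eqVneq x x0; last by apply: span_incl; exists x.
rewrite ex in Nx; case: Nx => u Mu ->; rewrite lieC; apply: spanN.
have := root_mono_compl Mu (v := gen x0); rewrite subKr => /(_ (Real_gen _)).
apply: span_sub => h' [y y0 Ny]; exists y => //; apply/eqP => e; move: y0.
by rewrite e !(weightE, nullwE) null_root0 // eqxx.
Qed.

End Sandwich.

(** * The universal property of L(0) *)

Section FreeLieLift.
Variables (K : fieldType) (X : Type) (L : lieAlgType K) (f : X -> L).

Fixpoint term_eval (s : lterm K X) : L :=
  match s with
  | TGen x => f x
  | TZero => 0
  | TOpp s => - term_eval s
  | TAdd s t => term_eval s + term_eval t
  | TScale a s => a *: term_eval s
  | TLie s t => lie (term_eval s) (term_eval t)
  end.

Lemma term_eval_teq s t : teq s t -> term_eval s = term_eval t.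
Proof.
elim=> {s t} //=.
- by move=> s t u _ -> _ ->.
- by move=> s s' _ ->.
- by move=> s s' t t' _ -> _ ->.
- by move=> a s s' _ ->.
- by move=> s s' t t' _ -> _ ->.
- by move=> s t u; rewrite addrA.
- by move=> s t; rewrite addrC.
- by move=> s; rewrite add0r.
- by move=> s; rewrite addNr.
- by move=> a b s; rewrite scalerA.
- by move=> s; rewrite scale1r.
- by move=> a s t; rewrite scalerDr.
- by move=> a b s; rewrite scalerDl.
- by move=> a s t u; rewrite lieDl lieZl.
- by move=> a s t u; rewrite lieDr lieZr.
- by move=> s; rewrite liexx.
- by move=> s t u; rewrite lie_jacobi.
Qed.

Lemma freeLie_lift : exists F : freeLie K X -> L,
  [/\ linear F, {morph F : u v / lie u v} & forall x, F (fgen K x) = f x].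
Proof.
exists (fun u => term_eval (repr u)).
have E s : term_eval (repr (fpi s)) = term_eval s.
  exact/term_eval_teq/repr_fpi.
split=> [a u v|u v|x]; last exact: E.
- rewrite -[u]fpiK -[v]fpiK; set s := repr u; set r := repr v.
  have -> : a *: fpi s + fpi r = fpi (TAdd (TScale a s) r).
    by rewrite -fpi_add -fpi_scale.
  by rewrite !E.
- rewrite -[u]fpiK -[v]fpiK; set s := repr u; set r := repr v.
  have -> : lie (fpi s) (fpi r) = fpi (TLie s r) by rewrite -fpi_lie.
  by rewrite !E.
Qed.

End FreeLieLift.

Lemma lquot_lift (K : fieldType) (L L' : lieAlgType K) (S : set L) (F : L -> L') :
  linear F -> {morph F : u v / lie u v} -> (forall u, S u -> F u = 0) ->
  exists G : lquot (ideal_gen S) -> L',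
    [/\ linear G, {morph G : u v / lie u v} & forall u, G (lqpi _ u) = F u].
Proof.
move=> lF mF F0.
have FD := linear_mapD lF; have FZ := linear_mapZ lF; have FN := linear_mapN lF.
have kill u : in_ideal_gen S u -> F u = 0.
  elim=> {u} [u /F0 //||u v _ u0 _ v0|a u _ u0|u v _ v0].
  - exact: linear_map0 lF.
  - by rewrite FD u0 v0 addr0.
  - by rewrite FZ u0 scaler0.
  - by rewrite mF v0 lie0r.
have E u : F (repr (lqpi (ideal_gen S) u)) = F u.
  have /asboolP/kill := qpi_reprB (ideal_gen S) u.
  by rewrite FD FN => /eqP; rewrite subr_eq0 => /eqP.
exists (fun u => F (repr u)); split=> [a u v|u v|//].
- by rewrite -[u]lqpiK -[v]lqpiK -linearP !E lF.
- by rewrite -[u]lqpiK -[v]lqpiK -[lie _ _]lqpi_lie !E mF.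
Qed.

Section L0Presentation.
Variables (K : fieldType) (t : affine_type).
Implicit Types (x y : vertex t).

Lemma ideal_lqpi0 (L : lieAlgType K) (S : set L) u : S u -> lqpi (ideal_gen S) u = 0.
Proof.
move=> Su; rewrite -(linear0 (lqpi (ideal_gen S))); apply/qpi_eqP.
by rewrite subr0; apply/asboolP/IGen.
Qed.

Lemma L0_gen_comm x y : ~~ adjacent x y -> lie (L0_gen K x) (L0_gen K y) = 0.
Proof.
move=> nxy; have h : lie (calF_gen K x) (calF_gen K y) = 0.
  by rewrite -[LHS]lqpi_lie ideal_lqpi0 //; exists x, y.
by rewrite -[LHS]lqpi_lie h linear0.
Qed.

Lemma L0_gen_sandwich x (u : L0 K t) : lie (L0_gen K x) (lie (L0_gen K x) u) = 0.
Proof.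
rewrite -[u]lqpiK; set v := repr u.
have -> : lie (L0_gen K x) (lie (L0_gen K x) (lqpi _ v))
    = lqpi _ (lie (calF_gen K x) (lie (calF_gen K x) v)) by rewrite !lqpi_lie.
by apply: ideal_lqpi0; exists x, v.
Qed.

Lemma L0_lift (L : lieAlgType K) (f : vertex t -> L) :
  (forall x y, ~~ adjacent x y -> lie (f x) (f y) = 0) ->
  (forall x u, lie (f x) (lie (f x) u) = 0) ->
  exists G : L0 K t -> L,
    [/\ linear G, {morph G : u v / lie u v} & forall x, G (L0_gen K x) = f x].
Proof.
move=> comm sandw; have [F [lF mF FE]] := freeLie_lift f.
have [|F' [lF' mF' F'E]] := lquot_lift lF mF (S := [set z | exists x y : vertex t,
    ~~ adjacent x y /\ z = lie (fgen K x) (fgen K y)]).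
  by move=> _ [x [y [nxy ->]]]; rewrite mF !FE comm.
have [|G [lG mG GE]] := lquot_lift lF' mF' (S := [set z : calF K t |
    exists (x : vertex t) (y : calF K t), z = lie (calF_gen K x) (lie (calF_gen K x) y)]).
  by move=> _ [x [y ->]]; rewrite !mF' /calF_gen F'E FE sandw.
by exists G; split=> // x; rewrite /L0_gen GE /calF_gen F'E FE.
Qed.

(** Brackets of monomials are monomials, so their span contains the image of
    every Lie term. *)
Lemma L0_span_monomial (u : L0 K t) : span [set v | exists mu, L0_monomial mu v] u.
Proof.
set T := span _.
have Tlie v w : T v -> T w -> T (lie v w).
  move=> + Tw; apply: (span_linear (lie_linearl w)) => {}v [mu Mv].
  move: w Tw; apply: (span_linear (lie_linearr v)) => w [nu Mw].
  by apply: span_incl; exists (mu + nu); exact: Mon_lie.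
pose pi s : L0 K t := lqpi _ (lqpi _ (fpi s)).
suff Tpi s : T (pi s) by rewrite -[u]lqpiK -[repr u]lqpiK -[repr (repr u)]fpiK; exact: Tpi.
elim: s => [x||s Ts|s Ts r Tr|a s Ts|s Ts r Tr].
- by apply: span_incl; exists (alpha x); exact: Mon_gen.
- have -> : pi (TZero K (vertex t)) = 0 by rewrite /pi -[fpi _]/(0 : freeLie _ _) !linear0.
  exact: span0.
- have -> : pi (TOpp s) = - pi s by rewrite /pi (esym (fpi_opp s) : _ = - fpi s) !linearN.
  exact: spanN.
- have -> : pi (TAdd s r) = pi s + pi r
    by rewrite /pi (esym (fpi_add s r) : _ = fpi s + fpi r) !linearD.
  exact: spanD.
- have -> : pi (TScale a s) = a *: pi s
    by rewrite /pi (esym (fpi_scale a s) : _ = a *: fpi s) !linearZ.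
  exact: spanZ.
- have -> : pi (TLie s r) = lie (pi s) (pi r).
    by rewrite /pi (esym (fpi_lie s r) : _ = lie (fpi s) (fpi r)) !lqpi_lie.
  exact: Tlie.
Qed.

End L0Presentation.

(** * Coordinates in a basis *)

Section SpanUniq.
Variables (K : fieldType) (V : lmodType K) (I : eqType) (P : set I) (e : I -> V).

(** Rewrites a combination with repeated vectors as one over distinct indices,
    the form in which independence is stated. *)
Lemma span_uniq v : span (e @` P) v ->
  exists (s : seq I) (c : I -> K),
    [/\ uniq s, forall i, i \in s -> P i & v = \sum_(i <- s) c i *: e i].
Proof.
move: v; apply: span_elim => [|u v [s [c [Us Ps ->]]] [r [d [Ur Pr ->]]]|a v [s [c [Us Ps ->]]]|].
- by exists [::], (fun=> 0); rewrite big_nil.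
- pose q := undup (s ++ r).
  have ext (w : seq I) (f : I -> K) : uniq w -> {subset w <= q} ->
      \sum_(i <- w) f i *: e i = \sum_(i <- q) (if i \in w then f i else 0) *: e i.
    move=> Uw wq; transitivity (\sum_(i <- q | i \in w) f i *: e i); last first.
      by rewrite big_mkcond; apply: eq_bigr => i _; case: ifP; rewrite ?scale0r.
    rewrite -[RHS]big_filter; apply: perm_big; apply: uniq_perm => //.
      by rewrite filter_uniq // undup_uniq.
    by move=> i; rewrite mem_filter andb_idr // => /wq.
  exists q, (fun i => (if i \in s then c i else 0) + (if i \in r then d i else 0)).
  split; first exact: undup_uniq.
    by move=> i; rewrite mem_undup mem_cat => /orP[/Ps|/Pr].
  rewrite (ext s c) // => [|i si]; last by rewrite mem_undup mem_cat si.
  rewrite (ext r d) // => [|i ri]; last by rewrite mem_undup mem_cat ri orbT.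
  by rewrite -big_split; apply: eq_bigr => i _; rewrite scalerDl.
- exists s, (fun i => a * c i); split=> //.
  by rewrite scaler_sumr; apply: eq_bigr => i _; rewrite scalerA.
- move=> _ [i Pi <-]; exists [:: i], (fun=> 1); rewrite big_seq1 scale1r; split=> //.
  by move=> j; rewrite inE => /eqP ->.
Qed.

End SpanUniq.

Lemma basis_disjoint_span (K : fieldType) (V : lmodType K) (I : eqType) (P A B : set I)
    (e : I -> V) v : is_basis P e ->
  (forall i, A i -> P i) -> (forall i, B i -> P i) -> (forall i, A i -> ~ B i) ->
  span (e @` A) v -> span (e @` B) v -> v = 0.
Proof.
move=> [_ free] AP BP AB /span_uniq[s [c [Us As ->]]] /span_uniq[r [d [Ur Br vE]]].
have disj i : i \in s -> (i \in r) = false.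
  by move=> /As Ai; apply/negP => /Br; exact: AB.
have /free h : uniq (s ++ r).
  by rewrite cat_uniq Us Ur andbT /=; apply/hasPn => i ir; apply/negP => /disj; rewrite ir.
have sz i : i \in s -> c i = 0.
  move=> si; have := h (fun i => if i \in s then c i else - d i); rewrite big_cat /=.
  have -> : \sum_(i <- s) (if i \in s then c i else - d i) *: e i = \sum_(i <- s) c i *: e i.
    by rewrite big_seq [RHS]big_seq; apply: eq_bigr => j ->.
  have -> : \sum_(i <- r) (if i \in s then c i else - d i) *: e i = - \sum_(i <- r) d i *: e i.
    rewrite big_seq -sumrN [RHS]big_seq; apply: eq_bigr => j jr.
    by case: ifP => [/disj|_]; rewrite ?jr // scaleNr.
  rewrite -vE subrr => /(_ _ erefl i); rewrite si mem_cat si; apply=> // j.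
  by rewrite mem_cat => /orP[/As/AP|/Br/BP].
by rewrite big_seq big1 // => i /sz ->; rewrite scale0r.
Qed.

(** * Brackets in the Chevalley algebra *)

Section Chevalley.
Variables (t : affine_type) (R : realType) (K : fieldType).
Variable g : chevalley_algebra t R K.
Implicit Types (x y : vertex t) (a b c : weight t).

Local Notation E := (chev_E g).
Local Notation H := (chev_H g).
Local Notation N := (nplus g).

Let zspan_E b : root0 b -> cx_span (cx_E g b).
Proof. by move=> rb; exact: zspan_incl 1 (cx_index_root g rb). Qed.

Let zspan_H x : x != x0 -> cx_span (cx_H g x).
Proof.
move=> xn0; rewrite -[cx_H g x]mulr1n; apply: zspan_incl.
by exists (inl x).
Qed.

(** The string of roots through b in direction a starts at b, because
    <a, b> = -1 makes b - a longer than a root; so the structure constant is 1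
    or -1. *)
Lemma chev_EE a b : root0 a -> root0 b -> root0 (a + b) ->
  eq_sign (lie (E a) (E b)) (E (a + b)).
Proof.
move=> ra rb rab; have [_ aa] := root0_norm ra; have [_ bb] := root0_norm rb.
have [_] := root0_norm rab; rewrite !cformE aa bb [cform b a]cformC => ab.
rewrite -!cx_red_root // -cx_red_lie; try exact: zspan_E.
have [p [rp _] hp] := cb_EE (cx_basis g) ra rb rab.
have p0 : p = 0%N.
  have [_] := root0_norm rp; rewrite pmulrn !(cformE, cformMzl, cformMzr) aa bb.
  by rewrite [cform b a]cformC; nia.
move: hp; rewrite p0 mulr1n => -[->|->]; first by left.
by right; rewrite -[cx_E g _]mulr1n cx_red_oppn // mulr1n cx_red_root.
Qed.

Lemma chev_EE0 a b : root0 a -> root0 b -> a + b <> 0 -> ~ root0 (a + b) ->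
  lie (E a) (E b) = 0.
Proof.
move=> ra rb ab nab; rewrite -!cx_red_root // -cx_red_lie; try exact: zspan_E.
by rewrite (cb_EE0 (cx_basis g)) // cx_red0.
Qed.

Lemma chev_EN x : x != x0 -> lie (E (alpha x)) (E (- alpha x)) = H x.
Proof.
move=> xn0; have rx : root0 (alpha x) by exact: Root_simple.
have rNx := root0N rx.
rewrite -!cx_red_root // -cx_red_lie; try exact: zspan_E.
rewrite (cb_EN (cx_basis g)) // (bigD1 x) //= big1 ?addr0.
  by rewrite weight_alpha eqxx mulr1z; exact: (@cx_redE _ _ _ g (inl x)).
by move=> y /andP[_ /negPf yx]; rewrite weight_alpha yx mulr0z.
Qed.

Lemma chev_HE x b : x != x0 -> root0 b -> exists k, lie (H x) (E b) = k *: E b.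
Proof.
move=> xn0 rb; rewrite -[H x](@cx_redE _ _ _ g (inl x) xn0) /= -!cx_red_root // -cx_red_lie.
- rewrite (cb_HE (cx_basis g)) // scaler_int cx_red_root //.
  case: (cform _ _) => n; rewrite -?pmulrn ?NegzE ?mulrNz -?pmulrn.
    by exists n%:R; rewrite cx_red_muln // scaler_nat.
  by exists (- n.+1%:R); rewrite cx_red_oppn // scaleNr scaler_nat.
- exact: zspan_H.
- exact: zspan_E.
Qed.

Lemma nplus_E b : pos_root b -> E b \in N.
Proof. by move=> pb; apply/asboolP/span_incl; exists b. Qed.

Lemma pos_root_simple x : x != x0 -> pos_root (alpha x).
Proof.
move=> xn0; split; first exact: Root_simple.
by move=> y; rewrite weight_alpha; case: eqP.
Qed.

(** If alpha_x + b is a root, then 2 alpha_x + b has norm 6 and is not. *)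
Lemma chev_ad2_root x b : x != x0 -> root0 b -> b <> - alpha x ->
  lie (E (alpha x)) (lie (E (alpha x)) (E b)) = 0.
Proof.
move=> xn0 rb bx; have rx : root0 (alpha x) by exact: Root_simple.
have [rab|nrab] := pselect (root0 (alpha x + b)); last first.
  rewrite [lie _ (E b)]chev_EE0 ?lie0r // => e; apply: bx.
  by apply/eqP; rewrite -addr_eq0 addrC e.
suff z : lie (E (alpha x)) (E (alpha x + b)) = 0.
  by case: (chev_EE rx rb rab) => ->; rewrite ?lieNr z ?oppr0.
have [_ bb] := root0_norm rb; have [_] := root0_norm rab.
rewrite !cformE bb [cform b _]cformC => c1.
have n6 : cform (alpha x + (alpha x + b)) (alpha x + (alpha x + b)) = 6.
  by rewrite !cformE bb [cform b _]cformC; lia.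
apply: chev_EE0 => // [e|/root0_norm[_]]; last by rewrite n6.
by move: n6; rewrite e -(mulr0z (alpha x)) cformMzl mul0r.
Qed.

Lemma chev_ad2_nplus x v : x != x0 -> v \in N ->
  lie (E (alpha x)) (lie (E (alpha x)) v) = 0.
Proof.
move=> xn0 /asboolP; move: v; apply: span_elim.
- by rewrite !lie0r.
- by move=> u v hu hv; rewrite !lieDr hu hv addr0.
- by move=> a v hv; rewrite !lieZr hv scaler0.
- move=> _ [b [rb b0] <-]; apply: chev_ad2_root => // e.
  by have := b0 x; rewrite e weightN weight_alpha eqxx.
Qed.

Lemma chev_H_simple x y : x != x0 -> y != x0 -> lie (E (alpha x)) (H y) \in N.
Proof.
move=> xn0 yn0; have [k hk] := chev_HE yn0 (Root_simple xn0).
by rewrite lieC hk rpredN rpredZ // nplus_E //; exact: pos_root_simple.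
Qed.

(** The only root vector that can have a nonzero double bracket is the one of
    -alpha_x, by [chev_ad2_root], and
    its double bracket is a multiple of the root vector of alpha_x. *)
Lemma chev_ad2 x v : x != x0 -> lie (E (alpha x)) (lie (E (alpha x)) v) \in N.
Proof.
move=> xn0; have [gen_g _] := chev_basis g; move: v (gen_g v); apply: span_elim.
- by rewrite !lie0r rpred0.
- by move=> u v hu hv; rewrite !lieDr rpredD.
- by move=> a v hv; rewrite !lieZr rpredZ.
- have Ex : E (alpha x) \in N by apply/nplus_E/pos_root_simple.
  move=> _ [[y|b] /= hi <-].
    by rewrite nplus_closed ?chev_H_simple.
  have [->|bx] := pselect (b = - alpha x); first by rewrite chev_EN // chev_H_simple.
  by rewrite chev_ad2_root //; exact/asboolP/span0.
Qed.

End Chevalley.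

(** * The semidirect product *)

Section Target.
Variables (t : affine_type) (R : realType) (K : fieldType).
Variable g : chevalley_algebra t R K.
Variables (delta : {ffun vertex t -> nat}) (hdelta : is_null_root delta).
Variables (theta : weight t) (htheta : lowest_root theta).
Implicit Types (x y : vertex t) (a b c : weight t).

Local Notation E := (chev_E g).
Local Notation H := (chev_H g).
Local Notation N := (nplus g).
Local Notation S := (semidirect N).
Local Notation nullw := (nullw delta).
Local Notation short_root := (short_root delta).

Definition to_nplus (v : g) : sublie N := insubd 0 v.

Lemma to_nplusK v : v \in N -> val (to_nplus v) = v.
Proof. by move=> Nv; rewrite /to_nplus val_insubd Nv. Qed.

Definition sd_quo (v : g) : S := (0, qpi N v).

Lemma sd_quo_linear : linear sd_quo.
Proof.
by move=> a u v; rewrite /sd_quo linearP; congr pair; rewrite /= scaler0 addr0.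
Qed.

Lemma sd_quo0 v : v \in N -> sd_quo v = 0.
Proof. by move=> Nv; congr pair; rewrite -(linear0 (qpi N)); apply: qpi_eqP; rewrite subr0. Qed.

Definition sd_sub (n : sublie N) : S := (n, 0).

Lemma sd_split (p : S) : exists v, p = sd_sub p.1 + sd_quo v.
Proof.
exists (repr p.2); case: p => n q; rewrite /sd_sub /sd_quo /= qpiK.
by congr pair; rewrite /= ?addr0 ?add0r.
Qed.

Lemma nact0r n : nact n 0 = 0 :> quotmod N.
Proof. exact: linear_map0 (nact_linear n). Qed.

Lemma nact0l q : nact 0 q = 0 :> quotmod N.
Proof. exact: linear_map0 (nact_linearl q). Qed.

Lemma sd_lie_sub_sub n m : lie (sd_sub n) (sd_sub m) = sd_sub (lie n m).
Proof. by congr pair; rewrite /= !nact0r subr0. Qed.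

Lemma sd_lie_sub_quo n v : lie (sd_sub n) (sd_quo v) = sd_quo (lie (val n) v).
Proof.
congr pair; first exact: (@lie0r _ (sublie N)).
by rewrite /= nact0l subr0 nact_qpi.
Qed.

Lemma sd_lie_quo_quo u v : lie (sd_quo u) (sd_quo v) = 0.
Proof.
congr pair; first exact: (@lie0r _ (sublie N)).
by rewrite /= !nact0l subr0.
Qed.

Lemma eq_sign_linear (V W : lmodType K) (f : V -> W) u v :
  linear f -> eq_sign u v -> eq_sign (f u) (f v).
Proof.
by move=> lf [->|->]; [left|right; rewrite linear_mapN].
Qed.

Lemma eq_sign_sub n m : eq_sign (val n) (val m) -> eq_sign (sd_sub n) (sd_sub m).
Proof.
case=> e; [left|right]; first by rewrite (val_inj e).
have -> : n = - m by apply: val_inj; rewrite e raddfN.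
by congr pair; rewrite /= oppr0.
Qed.

(** The basis vector of the semidirect product of weight b, for a short root b:
    the coordinate at x0 tells the two summands apart. *)
Definition sd_real b : S :=
  if b x0 == 0 then sd_sub (to_nplus (E b)) else sd_quo (E (b - nullw)).

Definition sd_null x : S := sd_quo (H x).

Let d0 := null_root0 hdelta.

Lemma short_x0 b : short_root b -> b x0 = 0 \/ b x0 = 1.
Proof. by case=> /(_ x0); rewrite d0; lia. Qed.

Lemma short_pos_root b : short_root b -> b x0 = 0 -> pos_root b.
Proof.
move=> sb b0; split; last by move=> x; exact: short_ge0 sb.
by apply/(root0P hdelta); split=> //; case: sb.
Qed.

Lemma short_neg_root b : short_root b -> b x0 = 1 -> root0 (b - nullw).
Proof.
move=> [_ bb] b0; apply/(root0P hdelta); split.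
  by rewrite !(weightE, nullwE) b0 d0.
by rewrite !cformE !cform_nullr // cform_nulll // bb.
Qed.

Lemma sd_real_sub b : short_root b -> b x0 = 0 -> sd_real b = sd_sub (to_nplus (E b)).
Proof. by move=> _ b0; rewrite /sd_real b0. Qed.

Lemma sd_real_quo b : b x0 = 1 -> sd_real b = sd_quo (E (b - nullw)).
Proof. by move=> b0; rewrite /sd_real b0. Qed.

(** Adding alpha_x corresponds to adding a root of g: alpha_x itself for x other
    than x0, and the lowest root for x0, which moves from the first summand to the
    second.  Every case reduces to [chev_EE]. *)
Lemma sd_real_lie b x : short_root b -> short_root (b + alpha x) ->
  eq_sign (lie (sd_real (alpha x)) (sd_real b)) (sd_real (b + alpha x)).
Proof.
move=> sb sbx.
have [ex|xn0] := eqVneq x x0.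
  have ax : alpha x x0 = 1 by rewrite weight_alpha ex eqxx.
  have b0 : b x0 = 0.
    have := short_x0 sb; have := short_x0 sbx; rewrite weightD ax.
    by case=> [|]; case=> [] ; lia.
  have bx : (b + alpha x) x0 = 1 by rewrite weightD ax b0.
  rewrite (sd_real_quo ax) (sd_real_quo bx) (sd_real_sub sb b0) lieC sd_lie_sub_quo.
  have pb := short_pos_root sb b0.
  rewrite to_nplusK ?nplus_E //.
  apply: (eq_sign_trans (v := sd_quo (lie (E b) (E (alpha x - nullw))))).
    by right.
  apply: eq_sign_linear; first exact: sd_quo_linear.
  rewrite -addrA; apply: chev_EE; first by case: pb.
    by apply: short_neg_root => //; exact: short_simple.
  by rewrite addrA; exact: short_neg_root.
have ax : alpha x x0 = 0 by rewrite weight_alpha eq_sym (negPf xn0).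
have px := pos_root_simple xn0; have [rx _] := px.
have sx := short_simple hdelta x.
rewrite (sd_real_sub sx ax).
have [b0|b0] := short_x0 sb.
  have bx : (b + alpha x) x0 = 0 by rewrite weightD ax b0.
  have pb := short_pos_root sb b0; have pbx := short_pos_root sbx bx.
  rewrite (sd_real_sub sb b0) (sd_real_sub sbx bx) sd_lie_sub_sub.
  apply: eq_sign_sub; rewrite /= !to_nplusK ?nplus_E //.
  by rewrite addrC; case: pb => rb _; case: pbx => rbx _; apply: chev_EE; rewrite // addrC.
have bx : (b + alpha x) x0 = 1 by rewrite weightD ax b0.
rewrite (sd_real_quo b0) (sd_real_quo bx) sd_lie_sub_quo to_nplusK ?nplus_E //.
apply: eq_sign_linear; first exact: sd_quo_linear.
have -> : b + alpha x - nullw = alpha x + (b - nullw) by rewrite addrA [alpha x + b]addrC.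
apply: chev_EE => //; first exact: short_neg_root.
rewrite addrA [alpha x + b]addrC; exact: short_neg_root.
Qed.

Definition sd_gen x : S := sd_real (alpha x).

Lemma sd_gen_sub x : x != x0 -> sd_gen x = sd_sub (to_nplus (E (alpha x))).
Proof.
move=> xn0; rewrite /sd_gen sd_real_sub // ?weight_alpha 1?eq_sym ?(negPf xn0) //.
exact: short_simple.
Qed.

Lemma sd_gen0 : sd_gen x0 = sd_quo (E theta).
Proof. by rewrite /sd_gen sd_real_quo ?weight_alpha ?eqxx // (lowest_rootE hdelta htheta). Qed.

Lemma sd_gen_null x : x != x0 ->
  lie (sd_gen x) (sd_real (nullw - alpha x)) = sd_null x.
Proof.
move=> xn0; have px := pos_root_simple xn0.
rewrite sd_gen_sub // sd_real_quo; last first.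
  by rewrite !(weightE, nullwE) d0 eq_sym (negPf xn0).
rewrite sd_lie_sub_quo to_nplusK ?nplus_E // addrC addrA addNr add0r.
by rewrite chev_EN.
Qed.

(** For x0 the square vanishes since g / n_+ is an abelian ideal; for the other
    vertices the double bracket kills n_+ and maps g to n_+. *)
Lemma sd_gen_sandwich x (p : S) : lie (sd_gen x) (lie (sd_gen x) p) = 0.
Proof.
have [v ->] := sd_split p; set n := p.1.
have [->|xn0] := eqVneq x x0.
  rewrite sd_gen0 !lieDr sd_lie_quo_quo lie0r addr0 [lie _ (sd_sub n)]lieC.
  by rewrite sd_lie_sub_quo lieNr sd_lie_quo_quo oppr0.
have px := pos_root_simple xn0; rewrite sd_gen_sub // !lieDr !sd_lie_sub_sub !sd_lie_sub_quo.
rewrite to_nplusK ?nplus_E // [sd_quo _]sd_quo0 ?addr0; last exact: chev_ad2.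
congr pair; apply: val_inj; rewrite /= !to_nplusK ?nplus_E //.
by rewrite chev_ad2_nplus //; case: n.
Qed.

(** For non-adjacent distinct vertices the corresponding roots of g are
    orthogonal, so their sum has norm 4 and is neither 0 nor a root. *)
Lemma sd_gen_comm x y : ~~ adjacent x y -> lie (sd_gen x) (sd_gen y) = 0.
Proof.
move=> nxy; have [->|xy] := eqVneq x y; first exact: liexx.
have c0 : cartan x y = 0 by rewrite /cartan (negPf xy) (negPf nxy).
have norm4 a b : cform a a = 2 -> cform b b = 2 -> cform a b = 0 ->
    a + b <> 0 /\ ~ root0 (a + b).
  move=> aa bb ab; have n4 : cform (a + b) (a + b) = 4.
    by rewrite !cformE aa bb [cform b a]cformC ab.
  split=> [e|/root0_norm[_]]; last by rewrite n4.
  by move: n4; rewrite e -(mulr0z a) cformMzl mul0r.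
have aux z : z != x0 -> cartan z x0 = 0 -> lie (sd_gen z) (sd_gen x0) = 0.
  move=> zn0 cz; rewrite sd_gen0 sd_gen_sub // sd_lie_sub_quo to_nplusK; last first.
    exact/nplus_E/pos_root_simple.
  have [[rt _] _] := htheta; have [_ tt] := root0_norm rt.
  have [|||h1 h2] := norm4 (alpha z) theta => //; first by rewrite !cformE.
    by rewrite (lowest_rootE hdelta htheta) !cformE cform_nullr // cz.
  by rewrite chev_EE0 ?(linear_map0 sd_quo_linear) //; exact: Root_simple.
have [ex|xn0] := eqVneq x x0.
  by rewrite ex lieC aux ?oppr0 // -ex 1?eq_sym // cartanC.
have [ey|yn0] := eqVneq y x0; first by rewrite ey aux // -ey.
rewrite !sd_gen_sub // sd_lie_sub_sub; congr pair; apply: val_inj => /=.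
rewrite !to_nplusK ?nplus_E //; try exact: pos_root_simple.
by have [|||h1 h2] := norm4 (alpha x) (alpha y); rewrite ?cformE // chev_EE0 //; exact: Root_simple.
Qed.

End Target.

(** * The isomorphism *)

(** Only generators have to be lifted through a linear map. *)
Lemma span_lift (K : fieldType) (U V W : lmodType K) (phi : U -> W) (psi : V -> W)
    (T : set U) (A : set V) : linear phi -> linear psi ->
  (forall v, A v -> exists2 u, span T u & phi u = psi v) ->
  forall v, span A v -> exists2 u, span T u & phi u = psi v.
Proof.
move=> lphi lpsi AT; apply: span_elim => [|v w [u Tu uE] [u' Tu' uE']|a v [u Tu uE]|v Av].
- by exists 0; [exact: span0|rewrite !linear_map0].
- by exists (u + u'); [exact: spanD|rewrite !linear_mapD // uE uE'].
- by exists (a *: u); [exact: spanZ|rewrite !linear_mapZ // uE].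
- exact: AT.
Qed.

Lemma linear_map_sum (K : fieldType) (V W : lmodType K) (f : V -> W) (I : Type)
    (s : seq I) (c : I -> K) (v : I -> V) : linear f ->
  f (\sum_(i <- s) c i *: v i) = \sum_(i <- s) c i *: f (v i).
Proof.
move=> lf; elim: s => [|i s IH]; first by rewrite !big_nil linear_map0.
by rewrite !big_cons lf IH.
Qed.

Lemma eq_sign_lift (K : fieldType) (V W : lmodType K) (f : V -> W) u w :
  linear f -> eq_sign (f u) w -> exists2 u', eq_sign u u' & f u' = w.
Proof.
move=> lf [fu|fu]; first by exists u; [left|].
by exists (- u); [right; rewrite opprK|rewrite linear_mapN // fu opprK].
Qed.

Section Isomorphism.
Variables (t : affine_type) (R : realType) (K : fieldType).
Variables (charK : 2%N \notin [pchar K]) (g : chevalley_algebra t R K).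
Variables (delta : {ffun vertex t -> nat}) (hdelta : is_null_root delta).
Variables (theta : weight t) (htheta : lowest_root theta).
Implicit Types (x y : vertex t) (b c : weight t).

Local Notation E := (chev_E g).
Local Notation H := (chev_H g).
Local Notation N := (nplus g).
Local Notation S := (semidirect N).
Local Notation L := (L0 K t).
Local Notation nullw := (nullw delta).
Local Notation short_root := (short_root delta).
Local Notation gen := (@L0_gen K t).
Local Notation root_mono := (root_mono delta gen).
Local Notation null_mono := (null_mono delta gen).
Local Notation spanning_mono := (spanning_mono delta gen).
Local Notation sd_real := (sd_real g delta).
Local Notation basis_elt := (chev_family H E).

Lemma L0_cartan_comm x y : cartan x y = 0 -> lie (gen x) (gen y) = 0.
Proof.
by rewrite /cartan; case: eqP => // _; case: ifP => // nxy _; rewrite L0_gen_comm ?nxy.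
Qed.

Let comm := L0_cartan_comm.
Let sandw := @L0_gen_sandwich K t.

Lemma root_mono_component b u : root_mono b u -> L0_monomial b u.
Proof.
elim=> {b u} [x|b x u _ IH _]; first exact: Mon_gen.
by rewrite addrC; apply: Mon_lie => //; exact: Mon_gen.
Qed.

Lemma spanning_mono_monomial b u : spanning_mono b u -> L0_monomial b u.
Proof.
case=> [/root_mono_component //|[-> [x [v /root_mono_component Mv ->]]]].
by rewrite -[nullw](subrKC (alpha x)); apply: Mon_lie => //; exact: Mon_gen.
Qed.

(** An arbitrary monomial is in the span of the special ones because that span
    contains the generators and is closed under brackets. *)
Lemma L0_component_mono b u : L0_component b u <-> span (spanning_mono b) u.
Proof.
split; last by apply: span_sub => v; exact: spanning_mono_monomial.
apply: (span_linear (f := id)) => // {}u; elim=> {b u} [x|b c u v _ Wu _ Wv].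
  by apply: span_incl; left; exact: Real_gen.
exact: span_spanning_mono_lie.
Qed.

(** The weight in the grading of the semidirect product of the basis vector
    coming from the root vector of b. *)
Definition affine_weight b : weight t := if `[< pos_root b >] then b else nullw + b.

Lemma affine_weight_short b : root0 b -> short_root (affine_weight b).
Proof.
move=> rb; rewrite /affine_weight; case: asboolP => [[_ b0]|nb];
    have [sb|sb] := root0_nullD hdelta htheta rb => //.
  have bz : b = 0.
    apply/ffunP => x; apply/eqP; rewrite ffunE eq_le b0 andbT.
    by have [/(_ x) /andP[_]] := sb; rewrite !(weightE, nullwE) gerDl.
  by have [_] := root0_norm rb; rewrite bz -(mulr0z (alpha x0)) cformMzl mul0r.
by case: nb; apply: (short_pos_root hdelta sb); case: (root0_norm rb).
Qed.

Lemma affine_weightK b : short_root b -> exists2 c, root0 c & affine_weight c = b.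
Proof.
move=> sb; have [b0|b1] := short_x0 hdelta sb.
  have pb := short_pos_root hdelta sb b0; exists b; first by case: pb.
  by rewrite /affine_weight asboolT.
have rc := short_neg_root hdelta sb b1; exists (b - nullw) => //.
rewrite /affine_weight asboolF ?subrKC // => -[_ c0].
have bz : b - nullw = 0.
  apply/ffunP => x; apply/eqP; rewrite [X in _ == X]ffunE eq_le c0 andbT.
  by have [/(_ x) /andP[_]] := sb; rewrite !(weightE, nullwE) subr_le0.
by have [_] := root0_norm rc; rewrite bz -(mulr0z (alpha x0)) cformMzl mul0r.
Qed.

Definition sd_basis (i : vertex t + weight t) : S :=
  match i with inl x => sd_null g x | inr b => sd_real (affine_weight b) end.

Definition pos_index (i : vertex t + weight t) : bool :=
  match i with inl _ => false | inr b => `[< pos_root b >] end.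

Lemma sd_basisE i : chev_index i ->
  sd_basis i = if pos_index i then sd_sub (to_nplus (basis_elt i)) else sd_quo (basis_elt i).
Proof.
case: i => [x|b] //= rb; have [b0 _] := root0_norm rb.
rewrite /affine_weight; case: asboolP => pb; first by rewrite /sd_real b0.
rewrite /sd_real !(weightE, nullwE) null_root0 // b0 /=.
by rewrite addrAC subrr add0r.
Qed.

Let sd_sub_linear : linear (@sd_sub t R K g).
Proof. by move=> a n m; congr pair; rewrite /= scaler0 addr0. Qed.

Let gbasis := chev_basis g.

(** The quotient map to g / n_+ is injective on the span of the Cartan part and
    the negative root vectors. *)
Lemma nplus_disjoint v : v \in N ->
  span (basis_elt @` [set i | chev_index i /\ ~~ pos_index i]) v -> v = 0.
Proof.
move=> /asboolP Nv;
apply: (basis_disjoint_span gbasis (A := [set i | pos_index i /\ chev_index i])).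
- by move=> i [].
- by move=> i [].
- by move=> i [pi _] [_]; rewrite pi.
- apply: span_sub Nv => _ [b pb <-]; exists (inr b) => //=.
  by split; [exact/asboolP|case: pb].
Qed.

(** The first component isolates the positive root vectors.  The second one puts
    the rest of the combination into n_+, where [nplus_disjoint] applies. *)
Lemma sd_basis_free (s : seq (vertex t + weight t)) (c : vertex t + weight t -> K) :
  uniq s -> (forall i, i \in s -> chev_index i) ->
  \sum_(i <- s) c i *: sd_basis i = 0 -> forall i, i \in s -> c i = 0.
Proof.
move=> Us Ps z; have [_ free] := gbasis.
have z1 : \sum_(i <- s) (if pos_index i then c i else 0) *: basis_elt i = 0.
  have lin1 : linear (fun p : S => val p.1).
    by move=> a p q; rewrite -[(a *: p + q).1]/(a *: p.1 + q.1) linearP.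
  have zE : \sum_(i <- s) c i *: val (sd_basis i).1 = 0.
    apply: etrans (linear_map0 lin1); rewrite -z.
    exact: esym (linear_map_sum s c sd_basis lin1).
  rewrite -[RHS]zE big_seq [RHS]big_seq.
  apply: eq_bigr => i si; rewrite (sd_basisE (Ps i si)); case: (boolP (pos_index i)) => pi /=.
    rewrite to_nplusK //; case: i pi {si} => //= b /asboolP; exact: nplus_E.
  by rewrite scale0r; exact: esym (scaler0 _ (c i)).
have z2 : \sum_(i <- s) (if pos_index i then 0 else c i) *: basis_elt i = 0.
  set v := \sum_(i <- s) _.
  have lin2 : linear (fun p : S => p.2 : quotmod N) by [].
  have : qpi N v = 0.
    rewrite (linear_map_sum _ _ _ (@qpi_linear _ _ N)).
    have zE : \sum_(i <- s) c i *: (sd_basis i).2 = 0.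
      apply: etrans (linear_map0 lin2); rewrite -z.
      exact: esym (linear_map_sum s c sd_basis lin2).
    rewrite -[RHS]zE big_seq [RHS]big_seq.
    apply: eq_bigr => i si; rewrite (sd_basisE (Ps i si)); case: (pos_index i) => //=.
    by rewrite scale0r scaler0.
  rewrite -[0 in RHS](linear0 (qpi N)) => /eqP; rewrite qpi_eq subr0 => Nv.
  apply: nplus_disjoint => //; rewrite /v big_seq; elim/big_rec: _ => [|i w si Sw].
    exact: span0.
  apply: spanD => //; case: (boolP (pos_index i)) => pi; first by rewrite scale0r; exact: span0.
  by apply/spanZ/span_incl; exists i => //=; split; [exact: Ps|].
move=> i si; have := free _ _ Us Ps z1 i si; have := free _ _ Us Ps z2 i si.
by case: (pos_index i).
Qed.

Variable phi : L -> S.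
Hypothesis phi_linear : linear phi.
Hypothesis phi_lie : {morph phi : u v / lie u v}.
Hypothesis phi_gen : forall x, phi (gen x) = sd_gen g delta x.

Lemma phi_root_mono b u : root_mono b u -> eq_sign (phi u) (sd_real b).
Proof.
elim=> {b u} [x|b x u Mu IH sbx]; first by rewrite phi_gen; left.
rewrite phi_lie phi_gen; apply: (eq_sign_trans (eq_sign_lie _ IH)).
exact: (sd_real_lie g hdelta (root_mono_short hdelta Mu) sbx).
Qed.

Lemma phi_null_mono x u : x != x0 -> null_mono x u -> eq_sign (phi u) (sd_null g x).
Proof.
move=> xn0 [v Mv ->]; rewrite phi_lie phi_gen -(sd_gen_null g hdelta xn0).
exact/eq_sign_lie/phi_root_mono.
Qed.

(** The elements of L(0) expected to go, up to sign, to the i-th basis vector. *)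
Definition L0_basis_kind (i : vertex t + weight t) (u : L) : Prop :=
  match i with inl x => null_mono x u | inr b => root_mono (affine_weight b) u end.

Lemma L0_basis_lift i : chev_index i -> exists u,
  phi u = sd_basis i /\ forall v, L0_basis_kind i v -> eq_sign v u.
Proof.
case: i => [x xn0|b rb] /=.
  have sx := short_compl hdelta (short_simple hdelta x).
  have [w Mw] := root_mono_ex hdelta gen sx.
  have Nw : null_mono x (lie (gen x) w) by exists w.
  have [u wu uE] := eq_sign_lift phi_linear (phi_null_mono xn0 Nw).
  exists u; split=> // _ [v Mv ->]; apply: eq_sign_trans wu; apply: eq_sign_lie.
  exact: (root_mono_uniq hdelta charK comm sandw Mv Mw).
have [w Mw] := root_mono_ex hdelta gen (affine_weight_short rb).
have [u wu uE] := eq_sign_lift phi_linear (phi_root_mono Mw).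
exists u; split=> // v Mv; apply: eq_sign_trans wu.
exact: (root_mono_uniq hdelta charK comm sandw Mv Mw).
Qed.

(** The lifts of the basis vectors span L(0), since each monomial, and
    each element of weight delta at a vertex other than x0, is one of them up to
    sign.  An element of the kernel is then a combination whose
    image is a vanishing combination of basis vectors. *)
Lemma phi_injective : injective phi.
Proof.
have [f fP] : exists f, forall i, chev_index i ->
    phi (f i) = sd_basis i /\ forall v, L0_basis_kind i v -> eq_sign v (f i).
  have /choice : forall i, exists u, chev_index i ->
      phi u = sd_basis i /\ forall v, L0_basis_kind i v -> eq_sign v u.
    move=> i; have [Pi|nPi] := pselect (chev_index i); last by exists 0.
    by have [u uP] := L0_basis_lift Pi; exists u.
  by case=> f fP; exists f.
have fspan i v : chev_index i -> L0_basis_kind i v -> span (f @` (@chev_index t)) v.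
  by move=> Pi kv; apply: (span_sign ((fP i Pi).2 v kv)); exists i.
have total u : span (f @` (@chev_index t)) u.
  have := L0_span_monomial u; apply: (span_linear (f := id)) => // {}u [b Mu].
  have /L0_component_mono : L0_component b u by exact: span_incl.
  move: u {Mu}; apply: (span_linear (f := id)) => // u mu.
  case: (mu) => [ru|[bE _]].
    have [c rc cE] := affine_weightK (root_mono_short hdelta ru).
    by apply: (fspan (inr c)) => //=; rewrite cE.
  rewrite bE in mu; have := null_mono_span hdelta charK comm sandw mu.
  move: u {mu}; apply: (span_linear (f := id)) => // u [x xn0 Nx].
  exact: (fspan (inl x)).
suff ker u : phi u = 0 -> u = 0.
  move=> u v uv; apply/eqP; rewrite -subr_eq0; apply/eqP/ker.
  by rewrite linear_mapD // linear_mapN // uv subrr.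
have [s [c [Us Ps ->]]] := span_uniq (total u).
rewrite (linear_map_sum _ _ _ phi_linear) => z.
have c0 := sd_basis_free Us Ps (c := c).
rewrite big_seq big1 // => i si; rewrite c0 ?scale0r //.
rewrite -[RHS]z big_seq [RHS]big_seq; apply: eq_bigr => j sj.
by rewrite (fP j (Ps j sj)).1.
Qed.

Lemma phi_real_ex b : short_root b -> exists2 u, span (spanning_mono b) u & phi u = sd_real b.
Proof.
move=> sb; have [w Mw] := root_mono_ex hdelta gen sb.
have [u wu uE] := eq_sign_lift phi_linear (phi_root_mono Mw); exists u => //.
by apply: (span_sign (eq_sign_sym wu)); left.
Qed.

Lemma phi_null_ex x : x != x0 -> exists2 u, span (spanning_mono nullw) u & phi u = sd_null g x.
Proof.
move=> xn0; have sx := short_compl hdelta (short_simple hdelta x).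
have [w Mw] := root_mono_ex hdelta gen sx.
have Nw : null_mono x (lie (gen x) w) by exists w.
have [u wu uE] := eq_sign_lift phi_linear (phi_null_mono xn0 Nw); exists u => //.
by apply: (span_sign (eq_sign_sym wu)); right; split=> //; exists x.
Qed.

Lemma phi_quo_ex b v : weight_space b v ->
  exists2 u, span (spanning_mono (nullw + b)) u & phi u = sd_quo v.
Proof.
move: v; apply: (span_lift phi_linear (@sd_quo_linear t R K g)) => v.
case=> [[rb ->]|[-> [x xn0 ->]]]; last by rewrite addr0; exact: phi_null_ex.
have [pb|nb] := pselect (pos_root b).
  by exists 0; [exact: span0|rewrite linear_map0 // sd_quo0 // nplus_E].
have := phi_real_ex (affine_weight_short rb); rewrite -/(sd_basis (inr b)) sd_basisE //=.
by rewrite /affine_weight asboolF.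
Qed.

Lemma phi_sub_ex b (n : sublie N) : weight_space b (val n) ->
  exists2 u, span (spanning_mono b) u & phi u = sd_sub n.
Proof.
move=> Wn; have [pb|nb] := pselect (pos_root b); last first.
  have n0 : val n = 0.
    apply: nplus_disjoint; first by case: (n).
    apply: span_sub Wn => v [[rb ->]|[b0 [x xn0 ->]]].
      by exists (inr b) => //=; split=> //; rewrite asboolF.
    by exists (inl x).
  exists 0; first exact: span0.
  rewrite linear_map0 //; have -> : n = 0 by exact: val_inj.
  by [].
have [rb b0] := pb.
have sb : short_root b by have := affine_weight_short rb; rewrite /affine_weight asboolT.
have [m Tm mE] : exists2 m : sublie N, span [set to_nplus (E b)] m & val m = val n.
  apply: (span_lift (psi := id) _ _ _ Wn) => // v.
  case=> [[_ ->]|[bz _]].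
    by exists (to_nplus (E b)); [exact: span_incl|rewrite to_nplusK // nplus_E].
  by have [_] := root0_norm rb; rewrite bz -(mulr0z (alpha x0)) cformMzl mul0r.
rewrite -(val_inj mE); move: m Tm {mE}; apply: (span_lift phi_linear sd_sub_linear) => _ ->.
have := phi_real_ex sb; rewrite sd_real_sub //; exact: (root0_norm rb).1.
Qed.

(** Homogeneous elements have homogeneous preimages.  With injectivity this gives
    the converse inclusion of graded parts without a direct sum argument. *)
Lemma sd_component_ex b p : sd_component delta b p ->
  exists2 u, span (spanning_mono b) u & phi u = p.
Proof.
case=> Wn [v Wv pE]; have [u Mu uE] := phi_sub_ex Wn.
have := phi_quo_ex Wv; rewrite subrKC => -[w Mw wE].
exists (u + w); first exact: spanD.
rewrite linear_mapD // uE wE; case: p pE {Wn uE} => n q /= ->.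
by congr pair; rewrite /= ?addr0 ?add0r.
Qed.

Lemma phi_surjective p : exists u, phi u = p.
Proof.
have [v ->] := sd_split p; set n := p.1.
suff [u uE] : exists u, phi u = sd_quo v.
  suff [w wE] : exists w, phi w = sd_sub n.
    by exists (w + u); rewrite linear_mapD // uE wE.
  have /asboolP Nn : val n \in N by case: n.
  have [m Tm mE] : exists2 m : sublie N,
      span [set m | exists2 b, pos_root b & m = to_nplus (E b)] m & val m = val n.
    apply: (span_lift (psi := id) _ _ _ Nn) => // _ [b pb <-].
    exists (to_nplus (E b)); last by rewrite to_nplusK // nplus_E.
    by apply: span_incl; exists b.
  have lift : forall m', (exists2 b, pos_root b & m' = to_nplus (E b)) ->
      exists2 w, span setT w & phi w = sd_sub m'.
    move=> _ [b pb ->]; have Wb : weight_space b (val (to_nplus (E b))).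
      by rewrite to_nplusK ?nplus_E //; apply: span_incl; left; case: pb.
    by have [w _ wE] := phi_sub_ex Wb; exists w => //; exact: span_incl.
  have [w _ wE] := span_lift phi_linear sd_sub_linear lift Tm.
  by exists w; rewrite wE (val_inj mE).
have [gen_g _] := gbasis.
have lift w : (basis_elt @` (@chev_index t)) w -> exists2 u, span setT u & phi u = sd_quo w.
  move=> [i Pi <-]; have [u [uE _]] := L0_basis_lift Pi.
  have [pi|npi] := boolP (pos_index i); last first.
    by exists u; [exact: span_incl|rewrite uE (sd_basisE Pi) (negPf npi)].
  exists 0; first exact: span0.
  rewrite linear_map0 // sd_quo0 //; case: i pi {Pi uE} => //= b /asboolP; exact: nplus_E.
have [u _ uE] := span_lift phi_linear (@sd_quo_linear t R K g) lift (gen_g v).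
by exists u.
Qed.

Lemma sd_component_span b p : span (sd_component delta b) p -> sd_component (g := g) delta b p.
Proof.
move: p; apply: span_elim => [|p q [Wp [v Wv pE]] [Wq [w Ww qE]]|a p [Wp [v Wv pE]]|//].
- by split; [exact: span0|exists 0; [exact: span0|exact: esym (linear0 (qpi N))]].
- split; first exact: spanD.
  by exists (v + w); [exact: spanD|rewrite -[(p + q).2]/(p.2 + q.2) pE qE linearD].
- split; first exact: spanZ.
  by exists (a *: v); [exact: spanZ|rewrite -[(a *: p).2]/(a *: p.2) pE linearZ].
Qed.

Lemma sd_real_component b : short_root b -> sd_component delta b (sd_real b).
Proof.
move=> sb; have [b0|b1] := short_x0 hdelta sb.
  have pb := short_pos_root hdelta sb b0; rewrite sd_real_sub //; split.
    by rewrite /= to_nplusK ?nplus_E //; apply: span_incl; left; case: pb.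
  by exists 0; [exact: span0|exact: esym (linear0 (qpi N))].
rewrite sd_real_quo //; split; first exact: span0.
exists (E (b - nullw)) => //; apply: span_incl; left; split=> //.
exact: short_neg_root.
Qed.

Lemma sd_null_component x : x != x0 -> sd_component delta nullw (sd_null g x).
Proof.
move=> xn0; split; first exact: span0.
exists (H x) => //; apply: span_incl; right; split; first by rewrite subrr.
by exists x.
Qed.

Lemma phi_component b u : L0_component b u -> sd_component delta b (phi u).
Proof.
move/L0_component_mono => Wu; apply: sd_component_span; move: u Wu.
apply: (span_linear phi_linear) => u; case=> [Mu|[bE [x Nx]]].
  apply: (span_sign (phi_root_mono Mu)); apply: sd_real_component.
  exact: (root_mono_short hdelta Mu).
have mu : spanning_mono nullw u by right; split=> //; exists x.
rewrite bE; have := null_mono_span hdelta charK comm sandw mu; move: u {Nx mu}.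
apply: (span_linear phi_linear) => u [y yn0 Ny].
exact: (span_sign (phi_null_mono yn0 Ny) (sd_null_component yn0)).
Qed.

Lemma phi_componentP b u : L0_component b u <-> sd_component delta b (phi u).
Proof.
split; first exact: phi_component.
by move=> /sd_component_ex[v Wv /phi_injective <-]; apply/L0_component_mono.
Qed.

End Isomorphism.

Theorem theorem13 (t : affine_type) (R : realType) (K : fieldType)
    (charK : 2%N \notin [pchar K]) (g : chevalley_algebra t R K)
    (delta : {ffun vertex t -> nat}) (hdelta : is_null_root delta)
    (theta : weight t) (htheta : lowest_root theta) :
  exists phi : {linear L0 K t -> semidirect (nplus g)},
    [/\ {morph phi : u v / lie u v >-> lie u v},
        bijective phi,
        forall x : vertex t, x != x0 ->
          val (phi (L0_gen K x)).1 = chev_E g (alpha x) /\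
          (phi (L0_gen K x)).2 = 0,
        (phi (L0_gen K x0)).1 = 0 /\
          (phi (L0_gen K x0)).2 = qpi (nplus g) (chev_E g theta) &
        forall (mu : weight t) (u : L0 K t),
          L0_component mu u <-> sd_component delta mu (phi u)].
Proof.
have [phi [lphi mphi phiE]] := L0_lift (@sd_gen_comm t R K g delta hdelta theta htheta)
  (sd_gen_sandwich hdelta htheta).
pose phiL : {linear L0 K t -> semidirect (nplus g)} :=
  HB.pack phi (GRing.isLinear.Build K (L0 K t) (semidirect (nplus g)) *:%R phi lphi).
have inj := phi_injective charK hdelta htheta lphi mphi phiE.
have surj := phi_surjective charK hdelta htheta lphi mphi phiE.
exists phiL; split=> //=.
- have [psi psiK] := choice surj.
  by exists psi => // u; apply: inj; rewrite psiK.
- move=> x xn0; rewrite phiE sd_gen_sub //=; split=> //.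
  by rewrite to_nplusK //; apply/nplus_E/pos_root_simple.
- by rewrite phiE (sd_gen0 g hdelta htheta).
- exact: (phi_componentP charK hdelta htheta lphi mphi phiE).
Qed.
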